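(* Let $b_1,b_2,c\in\mathbb{C}$ be such that all expressions below are non-singular (that is, none of $c,\ b_1,\ b_2,\ c-b_1,\ c-b_2$ is a non-positive integer). Then for $|z|<1$ $$ \begin{aligned} &(1-z)^{c-b_1-b_2}\sum_{k=0}^\infty\frac{(c-b_1)_k(c-b_2)_k}{(c)_k\,k!}\bigl(\psi(c-b_1+k)+\psi(c-b_2+k)-2\psi(c+k)\bigr)z^k\\ &\quad+\sum_{k=0}^\infty\frac{(b_1)_k(b_2)_k}{(c)_k\,k!}\bigl(2\psi(c+k)-\psi(b_1+k)-\psi(b_2+k)\bigr)z^k\\ &=\bigl(\psi(c-b_1)+\psi(c-b_2)-\psi(b_1)-\psi(b_2)\bigr)\,{}_2F_1\!\left(\begin{matrix}b_1,b_2\\ c\end{matrix}\middle|z\right). \end{aligned} $$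
   Context: $\psi=\Gamma'/\Gamma$ is the digamma function, $(x)_k=\Gamma(x+k)/\Gamma(x)$ the Pochhammer symbol, ${}_2F_1$ the Gauss hypergeometric function, and $(1-z)^{s}$ is the principal branch. *)

(* Defs.v *)
From Stdlib Require Import Factorial Reals.
From Coquelicot Require Import Coquelicot.

Local Open Scope C_scope.

Definition nonpos_int (w : C) : Prop := exists n : nat, w = RtoC (- INR n).

(* Limits of complex sequences and sums of complex series, taken componentwise
   since Coquelicot's total operators [Lim_seq] and [Series] are real-valued.
   As for these, the value is meaningful only in case of convergence. *)
Definition CLim_seq (u : nat -> C) : C :=
  (real (Lim_seq (fun n => Re (u n))), real (Lim_seq (fun n => Im (u n)))).

Definition CSeries (a : nat -> C) : C :=
  (Series (fun n => Re (a n)), Series (fun n => Im (a n))).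

(* The summands are those of Coquelicot's [is_pseries]. *)
Definition CPSeries (a : nat -> C) (z : C) : C :=
  CSeries (fun k => scal (pow_n z k : C) (a k)).

Definition Cexp (w : C) : C :=
  ((exp (Re w) * cos (Im w))%R, (exp (Re w) * sin (Im w))%R).

(* Principal argument, with values in (-PI, PI] for w <> 0. *)
Definition Carg (w : C) : R :=
  if Rle_dec 0 (Im w) then acos (Re w / Cmod w) else (- acos (Re w / Cmod w))%R.

Definition Clog (w : C) : C := (ln (Cmod w), Carg w).

Definition Cpower (w s : C) : C := Cexp (s * Clog w).

Fixpoint rising (x : C) (k : nat) : C :=
  match k with
  | O => RtoC 1
  | S k' => rising x k' * (x + RtoC (INR k'))
  end.

(* Euler's limit n! n^x / (x (x+1) ... (x+n)), which gives the Gamma function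
   on the whole of its domain: all complex x except the non-positive integers. *)
Definition Gamma (x : C) : C :=
  CLim_seq (fun n => RtoC (INR (fact n)) * Cpower (RtoC (INR n)) x
                     / rising x (S n)).

(* Coquelicot's total [C_derive] computes the limit of the difference quotient
   along the real direction; by [is_C_derive_unique] it is the complex
   derivative wherever the latter exists. *)
Definition digamma (x : C) : C := C_derive Gamma x / Gamma x.

(* Meaningful when neither x nor x + k is a pole of Gamma. *)
Definition pochhammer (x : C) (k : nat) : C :=
  Gamma (x + RtoC (INR k)) / Gamma x.

Definition hyp2F1_coef (a b c : C) (k : nat) : C :=
  pochhammer a k * pochhammer b k / (pochhammer c k * RtoC (INR (fact k))).

(* For Cmod z < 1 only: no analytic continuation is made. *)
Definition hyp2F1 (a b c z : C) : C := CPSeries (hyp2F1_coef a b c) z.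

(* Main.v *)
(* Euler's transformation reads (1-z)^(c-b1-b2) F(c-b1,c-b2;c;z) = F(b1,b2;c;z).
   It holds identically in e after replacing (b1,b2,c) by (b1+e,b2+e,c+2e), which
   leaves c-b1-b2 unchanged. Differentiating at e = 0 turns the coefficients into
   those of the statement with psi(x+k) replaced by the sum of 1/(x+j), j < k; the
   missing constants psi(x) are then restored by Euler's transformation itself.
   At the level of coefficients both identities say that the convolution with the
   binomial series satisfies the same first-order recurrence as the right-hand
   side, so that neither the parameter e nor a differential equation is needed. *)
Require Import Defs.
From Stdlib Require Import Factorial Reals Lra Lia.
From Coquelicot Require Import Coquelicot.

Local Open Scope C_scope.

(** The coefficient identities are pure algebra; most of the work lies in the functions behind the
    statement. [digamma] is built from [C_derive] and [CLim_seq], both total operators, so psi(x+1)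
    = psi(x) + 1/x becomes available only once Euler's limit is known to converge to a nonvanishing,
    complex differentiable function. One family of infinite products yields all of this: with F(x) =
    x Gamma(x), the quotient F(x+h)/F(x) is the product of the factors [euler_ratio x h n] = 1 + h
    g_n + O(h^2/n^2), where g_n = O(1/n^2), uniformly for small h. Base point 0 gives convergence, h
    = -x nonvanishing, h = 1 the functional equation, and h near 0 the derivative. Passing from
    coefficients to functions takes Cauchy products, hence absolute convergence, which follows from
    polynomial growth of every coefficient sequence involved. The principal power enters through the
    binomial series alone; the two are compared along the segment from 0 to z, where 1 - tz stays in
    the right half-plane. *)

Lemma C_eq (x y : C) : Re x = Re y -> Im x = Im y -> x = y.
Proof. destruct x, y; simpl; intros -> ->; reflexivity. Qed.

Lemma im_le_Cmod (c : C) : (Rabs (Im c) <= Cmod c)%R.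
Proof. eapply Rle_trans; [apply Rmax_r | apply Rmax_Cmod]. Qed.

Lemma Cmod_le_Re_Im (c : C) : (Cmod c <= Rabs (Re c) + Rabs (Im c))%R.
Proof.
  replace c with (RtoC (Re c) + Ci * RtoC (Im c)) at 1.
  2: apply C_eq; simpl; ring.
  eapply Rle_trans; [apply Cmod_triangle|].
  rewrite Cmod_mult, Cmod_Ci, !Cmod_R; lra.
Qed.

(** * The complex exponential *)

Lemma Cexp_plus (a b : C) : Cexp (a + b) = Cexp a * Cexp b.
Proof.
  apply C_eq; simpl; rewrite exp_plus, ?cos_plus, ?sin_plus; unfold Re, Im; ring.
Qed.

Lemma Cexp_RtoC (r : R) : Cexp (RtoC r) = RtoC (exp r).
Proof. apply C_eq; simpl; rewrite ?cos_0, ?sin_0; ring. Qed.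

Lemma Cexp_0 : Cexp (RtoC 0) = RtoC 1.
Proof. now rewrite Cexp_RtoC, exp_0. Qed.

Lemma Cmod_Cexp (a : C) : Cmod (Cexp a) = exp (Re a).
Proof.
  unfold Cmod; simpl.
  replace (_ + _)%R with ((exp (fst a)) ^ 2 * ((sin (snd a))² + (cos (snd a))²))%R
    by (unfold Rsqr, Re, Im; ring).
  rewrite sin2_cos2, Rmult_1_r, sqrt_pow2; auto.
  left; apply exp_pos.
Qed.

Lemma Cexp_opp_mult (a : C) : Cexp (- a) * Cexp a = RtoC 1.
Proof. rewrite <- Cexp_plus, <- Cexp_0; f_equal; ring. Qed.

(** * Complex functions of a real variable *)

Definition is_Rderive (f : R -> C) (t : R) (l : C) : Prop :=
  is_derive (fun u => Re (f u)) t (Re l) /\ is_derive (fun u => Im (f u)) t (Im l).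

Lemma is_Rderive_affine (a b : C) (t : R) :
  is_Rderive (fun u => a + RtoC u * b) t b.
Proof. split; simpl; auto_derive; auto; unfold Re, Im; ring. Qed.

Lemma is_Rderive_minus (f g : R -> C) (t : R) (df dg : C) :
  is_Rderive f t df -> is_Rderive g t dg ->
  is_Rderive (fun u => f u - g u) t (df - dg).
Proof.
  intros [Hf1 Hf2] [Hg1 Hg2]; split.
  - exact (is_derive_minus (fun u => Re (f u)) (fun u => Re (g u)) t _ _ Hf1 Hg1).
  - exact (is_derive_minus (fun u => Im (f u)) (fun u => Im (g u)) t _ _ Hf2 Hg2).
Qed.

Lemma is_Rderive_mult (f g : R -> C) (t : R) (df dg : C) :
  is_Rderive f t df -> is_Rderive g t dg ->
  is_Rderive (fun u => f u * g u) t (df * g t + f t * dg).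
Proof.
  intros [Hf1 Hf2] [Hg1 Hg2]; split; simpl.
  - evar_last.
    apply (is_derive_minus (fun u => Re (f u) * Re (g u))%R
                           (fun u => Im (f u) * Im (g u))%R t);
      apply (is_derive_mult (K := R_AbsRing)); eauto; exact Rmult_comm.
    unfold minus, plus, opp, mult; simpl; unfold Re, Im; ring.
  - evar_last.
    apply (is_derive_plus (fun u => Re (f u) * Im (g u))%R
                          (fun u => Im (f u) * Re (g u))%R t);
      apply (is_derive_mult (K := R_AbsRing)); eauto; exact Rmult_comm.
    unfold plus, mult; simpl; unfold Re, Im; ring.
Qed.

Lemma is_Rderive_Cexp (p : R -> C) (t : R) (dp : C) :
  is_Rderive p t dp -> is_Rderive (fun u => Cexp (p u)) t (dp * Cexp (p t)).
Proof.
  intros [H1 H2].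
  (* For abstract [f] and [g], [auto_derive] produces [Derive f t] and [Derive g t], which the
     rewriting below puts in place of [Re dp] and [Im dp]. *)
  assert (K : forall f g : R -> R, is_derive f t (Re dp) -> is_derive g t (Im dp) ->
    is_derive (fun u => exp (f u) * cos (g u))%R t
      (exp (f t) * (Re dp * cos (g t) - Im dp * sin (g t)))%R /\
    is_derive (fun u => exp (f u) * sin (g u))%R t
      (exp (f t) * (Re dp * sin (g t) + Im dp * cos (g t)))%R).
  { intros f g Hf Hg.
    rewrite <- (is_derive_unique _ _ _ Hf), <- (is_derive_unique _ _ _ Hg).
    split; auto_derive; try (split; [|split]; auto; eexists; eauto);
      change (fun x => f x) with f; change (fun x => g x) with g; ring. }
  destruct (K _ _ H1 H2) as [K1 K2]; split.
  - evar_last; [exact K1 | simpl; unfold Re, Im; ring].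
  - evar_last; [exact K2 | simpl; unfold Re, Im; ring].
Qed.

(** The real mean value inequality is applied to each component; adding the two bounds costs the
    factor 2. *)
Lemma is_Rderive_bound (f df : R -> C) (D : R) :
  (forall t, (Rabs t <= 1)%R -> is_Rderive f t (df t) /\ (Cmod (df t) <= D)%R) ->
  (Cmod (f 1%R - f 0%R) <= 2 * D)%R.
Proof.
  intros H.
  eapply Rle_trans; [apply Cmod_le_Re_Im|].
  assert (H1 : (Rabs (Re (f 1) - Re (f 0)) <= D * Rabs (1 - 0))%R).
  { apply (bounded_variation (fun u => Re (f u)) (fun u => Re (df u))).
    intros t Ht; destruct (H t) as [[A _] B].
    { rewrite !Rminus_0_r, Rabs_R1 in Ht; exact Ht. }
    split; [exact A | eapply Rle_trans; [apply re_le_Cmod | exact B]]. }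
  assert (H2 : (Rabs (Im (f 1) - Im (f 0)) <= D * Rabs (1 - 0))%R).
  { apply (bounded_variation (fun u => Im (f u)) (fun u => Im (df u))).
    intros t Ht; destruct (H t) as [[_ A] B].
    { rewrite !Rminus_0_r, Rabs_R1 in Ht; exact Ht. }
    split; [exact A | eapply Rle_trans; [apply im_le_Cmod | exact B]]. }
  rewrite Rminus_0_r, Rabs_R1 in H1, H2.
  change (Re (f 1%R - f 0%R)) with (Re (f 1%R) - Re (f 0%R))%R.
  change (Im (f 1%R - f 0%R)) with (Im (f 1%R) - Im (f 0%R))%R.
  lra.
Qed.

Lemma Cmod_scal_le (t : R) (w : C) :
  (Rabs t <= 1)%R -> (Cmod (RtoC t * w) <= Cmod w)%R.
Proof.
  intros Ht; rewrite Cmod_mult, Cmod_R.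
  rewrite <- (Rmult_1_l (Cmod w)) at 2.
  apply Rmult_le_compat_r; [apply Cmod_ge_0 | exact Ht].
Qed.

Lemma Cmod_Cexp_le (w : C) : (Cmod (Cexp w) <= exp (Cmod w))%R.
Proof.
  rewrite Cmod_Cexp.
  assert (H : (Re w <= Cmod w)%R)
    by (eapply Rle_trans; [apply Rle_abs | apply re_le_Cmod]).
  destruct H as [H | ->]; [left; now apply exp_increasing | right; reflexivity].
Qed.

Lemma exp_le (x y : R) : (x <= y -> exp x <= exp y)%R.
Proof. intros [H | ->]; [left; now apply exp_increasing | right; reflexivity]. Qed.

Lemma Cexp_bound1 (w : C) : (Cmod (Cexp w - RtoC 1) <= 2 * (Cmod w * exp (Cmod w)))%R.
Proof.
  replace (Cexp w - RtoC 1)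
    with (Cexp (RtoC 0 + RtoC 1 * w) - Cexp (RtoC 0 + RtoC 0 * w)).
  2: { replace (RtoC 0 + RtoC 0 * w) with (RtoC 0) by ring.
       replace (RtoC 0 + RtoC 1 * w) with w by ring. now rewrite Cexp_0. }
  apply (is_Rderive_bound (fun t => Cexp (RtoC 0 + RtoC t * w))
                          (fun t => w * Cexp (RtoC 0 + RtoC t * w))).
  intros t Ht; split.
  - apply is_Rderive_Cexp, is_Rderive_affine.
  - rewrite Cmod_mult; apply Rmult_le_compat_l; [apply Cmod_ge_0|].
    eapply Rle_trans; [apply Cmod_Cexp_le|]. apply exp_le.
    rewrite Cplus_0_l; now apply Cmod_scal_le.
Qed.

(** One order higher than [Cexp_bound1]: the t-derivative of exp(tw) - 1 - tw is w (exp(tw) - 1), to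
    which the first-order bound applies. The two factors 2 make the 4. *)
Lemma Cexp_bound2 (w : C) :
  (Cmod (Cexp w - RtoC 1 - w) <= 4 * (Cmod w * Cmod w * exp (Cmod w)))%R.
Proof.
  replace (Cexp w - RtoC 1 - w)
    with ((Cexp (RtoC 0 + RtoC 1 * w) - (RtoC 1 + RtoC 1 * w))
          - (Cexp (RtoC 0 + RtoC 0 * w) - (RtoC 1 + RtoC 0 * w))).
  2: { replace (RtoC 0 + RtoC 0 * w) with (RtoC 0) by ring.
       replace (RtoC 0 + RtoC 1 * w) with w by ring. rewrite Cexp_0; ring. }
  replace (4 * _)%R with (2 * (Cmod w * (2 * (Cmod w * exp (Cmod w)))))%R by ring.
  apply (is_Rderive_bound
           (fun t => Cexp (RtoC 0 + RtoC t * w) - (RtoC 1 + RtoC t * w))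
           (fun t => w * Cexp (RtoC 0 + RtoC t * w) - w)).
  intros t Ht; split.
  - apply is_Rderive_minus; [apply is_Rderive_Cexp|]; apply is_Rderive_affine.
  - replace (w * Cexp (RtoC 0 + RtoC t * w) - w)
      with (w * (Cexp (RtoC t * w) - RtoC 1)) by (rewrite Cplus_0_l; ring).
    rewrite Cmod_mult; apply Rmult_le_compat_l; [apply Cmod_ge_0|].
    eapply Rle_trans; [apply Cexp_bound1|].
    assert (H := Cmod_scal_le t w Ht).
    apply Rmult_le_compat_l; [lra|].
    apply Rmult_le_compat; auto using Cmod_ge_0, exp_le.
    left; apply exp_pos.
Qed.

(** * Convergence of complex sequences and products *)

Definition Clim (u : nat -> C) (l : C) : Prop :=
  is_lim_seq (fun n => Re (u n)) (Re l) /\ is_lim_seq (fun n => Im (u n)) (Im l).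

Lemma Clim_CLim_seq (u : nat -> C) (l : C) : Clim u l -> CLim_seq u = l.
Proof.
  intros [H1 H2]; apply C_eq; simpl.
  - now rewrite (is_lim_seq_unique _ _ H1).
  - now rewrite (is_lim_seq_unique _ _ H2).
Qed.

Lemma Clim_unique (u : nat -> C) (l l' : C) : Clim u l -> Clim u l' -> l = l'.
Proof. intros H H'; now rewrite <- (Clim_CLim_seq _ _ H), <- (Clim_CLim_seq _ _ H'). Qed.

Lemma Clim_ext_loc (u v : nat -> C) (l : C) (N : nat) :
  (forall n, (N <= n)%nat -> u n = v n) -> Clim u l -> Clim v l.
Proof.
  intros E [H1 H2]; split.
  - eapply is_lim_seq_ext_loc; [|exact H1]; exists N; intros; simpl; now rewrite E.
  - eapply is_lim_seq_ext_loc; [|exact H2]; exists N; intros; simpl; now rewrite E.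
Qed.

Lemma Clim_const (l : C) : Clim (fun _ => l) l.
Proof. split; apply is_lim_seq_const. Qed.

Lemma Clim_plus (u v : nat -> C) (l l' : C) :
  Clim u l -> Clim v l' -> Clim (fun n => u n + v n) (l + l').
Proof. intros [A1 A2] [B1 B2]; split; now apply is_lim_seq_plus'. Qed.

Lemma Clim_mult (u v : nat -> C) (l l' : C) :
  Clim u l -> Clim v l' -> Clim (fun n => u n * v n) (l * l').
Proof.
  intros [A1 A2] [B1 B2]; split; simpl.
  - now apply is_lim_seq_minus'; apply is_lim_seq_mult'.
  - now apply is_lim_seq_plus'; apply is_lim_seq_mult'.
Qed.

Lemma Clim_scal (a : C) (u : nat -> C) (l : C) :
  Clim u l -> Clim (fun n => a * u n) (a * l).
Proof. apply Clim_mult, Clim_const. Qed.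

Lemma Clim_Cmod_le (u : nat -> C) (l : C) (B : R) :
  (forall n, Cmod (u n) <= B)%R -> Clim u l -> (Cmod l <= B)%R.
Proof.
  intros H [H1 H2].
  (* The squared modulus is a polynomial in the components, so the limit rules for sums and products
     suffice. *)
  assert (L : is_lim_seq (fun n => Re (u n) * Re (u n) + Im (u n) * Im (u n))%R
                         (Re l * Re l + Im l * Im l)%R)
    by (apply is_lim_seq_plus'; now apply is_lim_seq_mult').
  assert (HB : (0 <= B)%R) by (eapply Rle_trans; [apply Cmod_ge_0 | apply (H O)]).
  apply Rsqr_incr_0_var; [|exact HB].
  rewrite !Rsqr_pow2, Cmod2_alt.
  replace (Re l ^ 2 + Im l ^ 2)%R with (Re l * Re l + Im l * Im l)%R by ring.
  apply (is_lim_seq_le _ (fun _ => B ^ 2)%R _ (B ^ 2)%R) with (2 := L).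
  - intro n.
    replace (_ + _)%R with (Cmod (u n) ^ 2)%R by (rewrite Cmod2_alt; ring).
    apply pow_incr; split; auto using Cmod_ge_0.
  - apply is_lim_seq_const.
Qed.

(* A multiple of [tele] dominates [1 / (n + 1)^2], and its partial sums are explicit. *)
Definition tele (n : nat) : R := (/ INR (S n) - / INR (S (S n)))%R.

Fixpoint csum (f : nat -> C) (n : nat) : C :=
  match n with O => RtoC 0 | S k => csum f k + f k end.

Fixpoint cprod (f : nat -> C) (n : nat) : C :=
  match n with O => RtoC 1 | S k => cprod f k * f k end.

Lemma INR_S_pos (n : nat) : (0 < INR (S n))%R.
Proof. apply lt_0_INR; lia. Qed.

Lemma INR_S_ge_1 (n : nat) : (1 <= INR (S n))%R.
Proof. rewrite S_INR; assert (H := pos_INR n); lra. Qed.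

Lemma inv_INR_S_pos (n : nat) : (0 < / INR (S n))%R.
Proof. apply Rinv_0_lt_compat, INR_S_pos. Qed.

Lemma tele_eq (n : nat) : (tele n = / INR (S n) * / INR (S (S n)))%R.
Proof.
  unfold tele; assert (H := INR_S_pos n); assert (H' := INR_S_pos (S n)).
  rewrite (S_INR (S n)) in *; field; lra.
Qed.

Lemma tele_pos (n : nat) : (0 < tele n)%R.
Proof. rewrite tele_eq; apply Rmult_lt_0_compat; apply inv_INR_S_pos. Qed.

Lemma inv_sqr_le_tele (n : nat) : (/ INR (S n) * / INR (S n) <= 2 * tele n)%R.
Proof.
  rewrite tele_eq; assert (H := inv_INR_S_pos n).
  replace (2 * _)%R with (/ INR (S n) * (2 * / INR (S (S n))))%R by ring.
  apply Rmult_le_compat_l; [lra|].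
  assert (H1 := INR_S_pos n); rewrite (S_INR (S n)).
  assert (1 <= INR (S n))%R by (rewrite S_INR; assert (Q := pos_INR n); lra).
  apply Rmult_le_reg_r with (INR (S n) * (INR (S n) + 1))%R; [nra|].
  field_simplify; lra.
Qed.

Lemma is_series_tele : is_series tele 1%R.
Proof.
  change (is_lim_seq (sum_n tele) 1%R).
  apply (is_lim_seq_ext (fun n => 1 - / INR (S (S n)))%R).
  - intro n; induction n as [|n IH].
    + rewrite sum_O; unfold tele; simpl; field.
    + rewrite sum_Sn, <- IH; unfold tele, plus; simpl; ring.
  - evar_last.
    apply is_lim_seq_minus'; [apply is_lim_seq_const|].
    apply (is_lim_seq_incr_1 (fun n => / INR (S n))%R 0%R).
    apply (is_lim_seq_incr_1 (fun n => / INR n)%R 0%R).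
    eapply (is_lim_seq_inv _ p_infty); [apply is_lim_seq_INR | easy].
    simpl; f_equal; ring.
Qed.

Lemma ex_lim_of_increments (u : nat -> R) (K : R) :
  (forall n, Rabs (u (S n) - u n) <= K * tele n)%R -> exists l : R, is_lim_seq u l.
Proof.
  intros H.
  destruct (ex_series_le (K := R_AbsRing) (V := R_CompleteNormedModule)
              (fun n => u (S n) - u n)%R (fun n => K * tele n)%R) as [l Hl].
  - exact H.
  - apply (ex_series_scal_l K tele); eexists; apply is_series_tele.
  - exists (l + u O)%R.
    apply is_lim_seq_incr_1.
    eapply is_lim_seq_ext; [|apply is_lim_seq_plus'; [exact Hl | apply (is_lim_seq_const (u O))]].
    intro n; simpl; induction n as [|n IH].
    + rewrite sum_O; ring.
    + rewrite sum_Sn; unfold plus; simpl; lra.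
Qed.

Lemma ex_Clim_of_increments (u : nat -> C) (K : R) :
  (forall n, Cmod (u (S n) - u n) <= K * tele n)%R -> exists l, Clim u l.
Proof.
  intros H.
  destruct (ex_lim_of_increments (fun n => Re (u n)) K) as [a Ha].
  { intro n; eapply Rle_trans; [|apply H]; exact (re_le_Cmod (u (S n) - u n)). }
  destruct (ex_lim_of_increments (fun n => Im (u n)) K) as [b Hb].
  { intro n; eapply Rle_trans; [|apply H]; exact (im_le_Cmod (u (S n) - u n)). }
  exists (a, b); split; assumption.
Qed.

Lemma cprod_le (f : nat -> C) (K : R) :
  (forall n, Cmod (f n - RtoC 1) <= K * tele n)%R ->
  forall n, (Cmod (cprod f n) <= exp K)%R.
Proof.
  intros H n.
  assert (HK : (0 <= K)%R).
  { assert (T := tele_pos 0); assert (Q := H O); assert (W := Cmod_ge_0 (f O - RtoC 1)). nra. }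
  (* Strengthened for the induction: 1 - 1/(n+1) is the sum of [tele] below n, and each factor has
     modulus at most 1 + K tele n <= exp (K tele n). *)
  assert (B : (Cmod (cprod f n) <= exp (K * (1 - / INR (S n))))%R).
  { induction n as [|n IH].
    - simpl; rewrite Cmod_1, Rinv_1, Rminus_diag, Rmult_0_r, exp_0; lra.
    - simpl cprod; rewrite Cmod_mult.
      replace (K * (1 - / INR (S (S n))))%R with (K * (1 - / INR (S n)) + K * tele n)%R
        by (unfold tele; ring).
      rewrite exp_plus; apply Rmult_le_compat; auto using Cmod_ge_0.
      eapply Rle_trans; [|apply exp_ineq1_le].
      replace (f n) with (RtoC 1 + (f n - RtoC 1)) by ring.
      eapply Rle_trans; [apply Cmod_triangle|].
      rewrite Cmod_1; specialize (H n); lra. }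
  eapply Rle_trans; [exact B|]. apply exp_le.
  assert (Q := inv_INR_S_pos n); nra.
Qed.

Lemma ex_Clim_cprod (f : nat -> C) (K : R) :
  (forall n, Cmod (f n - RtoC 1) <= K * tele n)%R -> exists l, Clim (cprod f) l.
Proof.
  intros H; apply ex_Clim_of_increments with (exp K * K)%R; intro n.
  replace (cprod f (S n) - cprod f n) with (cprod f n * (f n - RtoC 1)) by (simpl; ring).
  rewrite Cmod_mult, Rmult_assoc.
  apply Rmult_le_compat; auto using Cmod_ge_0, cprod_le.
Qed.

(** Here [a] stands for the modulus of a small parameter h and [g] for the part of [f - 1] that is
    linear in h. Writing P_n for the partial product, step n adds (f_n - 1 - g_n) + (P_n - 1)(f_n -
    1) to the error, and both terms are of order a^2. The bound does not depend on n, so it survives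
    the passage to the infinite product. *)
Lemma cprod_expansion (f g : nat -> C) (K a : R) :
  (0 <= a <= 1)%R ->
  (forall n, Cmod (f n - RtoC 1) <= a * K * tele n)%R ->
  (forall n, Cmod (f n - RtoC 1 - g n) <= a * a * K * tele n)%R ->
  forall n, (Cmod (cprod f n - RtoC 1 - csum g n) <= a * a * (K + exp K * K * K))%R.
Proof.
  intros Ha Hf Hg n.
  assert (HK : (0 <= a * K)%R).
  { assert (T := tele_pos 0); assert (Q := Hf O); assert (W := Cmod_ge_0 (f O - RtoC 1)). nra. }
  (* For a = 0 the sign of K cannot be recovered from 0 <= a K, but then every f_n is 1 and every
     g_n is 0. *)
  destruct (Rle_lt_or_eq_dec 0 a (proj1 Ha)) as [Ha0 | Ha0].
  2: { subst a.
    assert (E : cprod f n - RtoC 1 - csum g n = RtoC 0).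
    { assert (Ef : forall k, f k = RtoC 1).
      { intro k; specialize (Hf k); assert (W := Cmod_ge_0 (f k - RtoC 1)).
        replace (f k) with (RtoC 1 + (f k - RtoC 1)) by ring.
        rewrite (Cmod_eq_0 (f k - RtoC 1)); [ring | lra]. }
      assert (Eg : forall k, g k = RtoC 0).
      { intro k; specialize (Hg k); assert (W := Cmod_ge_0 (f k - RtoC 1 - g k)).
        replace (g k) with ((f k - RtoC 1) - (f k - RtoC 1 - g k)) by ring.
        rewrite (Cmod_eq_0 (f k - RtoC 1 - g k)); [rewrite Ef; ring | lra]. }
      clear - Ef Eg; induction n as [|n IH]; simpl; [ring|].
      rewrite Ef, Eg; etransitivity; [|exact IH]; ring. }
    rewrite E, Cmod_0; lra. }
  assert (HK0 : (0 <= K)%R) by nra.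
  assert (Hexp : (0 < exp K)%R) by apply exp_pos.
  assert (P : forall k, (Cmod (cprod f k) <= exp K)%R).
  { apply cprod_le; intro k; eapply Rle_trans; [apply Hf|].
    apply Rmult_le_compat_r; [left; apply tele_pos | nra]. }
  assert (P1 : forall k, (Cmod (cprod f k - RtoC 1) <= exp K * (a * K) * (1 - / INR (S k)))%R).
  { intro k; induction k as [|k IH].
    - simpl; replace (RtoC 1 - RtoC 1) with (RtoC 0) by ring.
      rewrite Cmod_0, Rinv_1; lra.
    - replace (cprod f (S k) - RtoC 1)
        with ((cprod f k - RtoC 1) + cprod f k * (f k - RtoC 1)) by (simpl; ring).
      eapply Rle_trans; [apply Cmod_triangle|].
      replace (1 - / INR (S (S k)))%R with ((1 - / INR (S k)) + tele k)%R
        by (unfold tele; ring).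
      rewrite Rmult_plus_distr_l; apply Rplus_le_compat; [exact IH|].
      rewrite Cmod_mult, Rmult_assoc.
      apply Rmult_le_compat; auto using Cmod_ge_0. }
  assert (P2 : (Cmod (cprod f n - RtoC 1 - csum g n)
                <= a * a * (K + exp K * K * K) * (1 - / INR (S n)))%R).
  { induction n as [|n IH].
    - simpl; replace (RtoC 1 - RtoC 1 - RtoC 0) with (RtoC 0) by ring.
      rewrite Cmod_0, Rinv_1; lra.
    - replace (cprod f (S n) - RtoC 1 - csum g (S n))
        with ((cprod f n - RtoC 1 - csum g n)
              + ((f n - RtoC 1 - g n) + (cprod f n - RtoC 1) * (f n - RtoC 1)))
        by (simpl; ring).
      eapply Rle_trans; [apply Cmod_triangle|].
      replace (1 - / INR (S (S n)))%R with ((1 - / INR (S n)) + tele n)%R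
        by (unfold tele; ring).
      rewrite Rmult_plus_distr_l; apply Rplus_le_compat; [exact IH|].
      eapply Rle_trans; [apply Cmod_triangle|].
      rewrite Cmod_mult.
      replace (a * a * (K + exp K * K * K) * tele n)%R
        with (a * a * K * tele n + (exp K * (a * K)) * (a * K * tele n))%R by ring.
      apply Rplus_le_compat; [apply Hg|].
      apply Rmult_le_compat; auto using Cmod_ge_0.
      eapply Rle_trans; [apply P1|].
      assert (Q := inv_INR_S_pos n).
      rewrite <- (Rmult_1_r (exp K * (a * K))) at 2.
      apply Rmult_le_compat_l; nra. }
  eapply Rle_trans; [exact P2|].
  assert (Q := inv_INR_S_pos n).
  rewrite <- (Rmult_1_r (a * a * _)) at 2.
  apply Rmult_le_compat_l; [|lra].
  apply Rmult_le_pos; [nra|]. assert (0 <= exp K * K)%R by nra. nra.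
Qed.

(** * Complex derivatives *)

(* The remainder is required to be quadratic, which holds for every analytic
   function and makes the calculus rules below purely algebraic. *)
Definition is_Cderive (f : C -> C) (x l : C) : Prop :=
  exists d K : R, (0 < d)%R /\
    forall h, (Cmod h <= d)%R ->
      (Cmod (f (x + h)%C - f x - h * l) <= K * (Cmod h * Cmod h))%R.

Lemma is_Cderive_C_derive (f : C -> C) (x l : C) :
  is_Cderive f x l -> C_derive f x = l.
Proof.
  intros (d & K & Hd & H).
  apply is_C_lim_unique.
  intros P [eps HP].
  assert (HK : (0 < Rabs K + 1)%R) by (assert (Q := Rabs_pos K); lra).
  (* Neighbourhoods in [C] are squares, so a radius r only gives |h| < 2r; this explains both
     halvings. The summand 1 keeps the denominator positive for every K. *)
  assert (Hdel : (0 < Rmin (d / 2) (eps / (2 * (Rabs K + 1))))%R).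
  { apply Rmin_case; [lra|]. apply Rdiv_lt_0_compat; [apply cond_pos | lra]. }
  exists (mkposreal _ Hdel); intros y [By1 By2] Hy; change C in y.
  simpl in By1, By2.
  assert (Hh : (Cmod (y - x) < 2 * Rmin (d / 2) (eps / (2 * (Rabs K + 1))))%R).
  { eapply Rle_lt_trans; [apply Cmod_le_Re_Im|].
    assert (Q1 : (Rabs (Re (y - x)) < Rmin (d / 2) (eps / (2 * (Rabs K + 1))))%R) by exact By1.
    assert (Q2 : (Rabs (Im (y - x)) < Rmin (d / 2) (eps / (2 * (Rabs K + 1))))%R) by exact By2.
    lra. }
  assert (Hne : y - x <> RtoC 0).
  { intro E; apply Hy; change (@eq C y x).
    transitivity ((y - x) + x); [ring | rewrite E; ring]. }
  assert (Hpos := proj1 (Cmod_gt_0 _) Hne).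
  assert (M1 := Rmin_l (d / 2) (eps / (2 * (Rabs K + 1)))).
  assert (M2 := Rmin_r (d / 2) (eps / (2 * (Rabs K + 1)))).
  assert (Hh' : (Cmod (y - x) <= d)%R) by lra.
  specialize (H _ Hh').
  replace (x + (y - x)) with y in H by ring.
  assert (Q : (Cmod ((f y - f x) / (y - x) - l) < eps)%R).
  { replace ((f y - f x) / (y - x) - l)
      with ((f y - f x - (y - x) * l) / (y - x)) by (field; exact Hne).
    rewrite Cmod_div by exact Hne.
    apply Rmult_lt_reg_r with (Cmod (y - x)); [exact Hpos|].
    unfold Rdiv; rewrite Rmult_assoc, Rinv_l, Rmult_1_r by lra.
    eapply Rle_lt_trans; [exact H|].
    rewrite <- Rmult_assoc; apply Rmult_lt_compat_r; [exact Hpos|].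
    assert (E : ((Rabs K + 1) * Cmod (y - x) < eps)%R).
    { apply Rlt_le_trans with ((Rabs K + 1) * (2 * (eps / (2 * (Rabs K + 1)))))%R.
      - apply Rmult_lt_compat_l; [exact HK | lra].
      - right; field; lra. }
    assert (W := Rle_abs K); nra. }
  apply HP; split.
  - eapply Rle_lt_trans; [|exact Q].
    exact (re_le_Cmod ((f y - f x) / (y - x) - l)).
  - eapply Rle_lt_trans; [|exact Q].
    exact (im_le_Cmod ((f y - f x) / (y - x) - l)).
Qed.

Lemma is_Cderive_ext_loc (f g : C -> C) (x l : C) (d : R) :
  (0 < d)%R -> (forall h, (Cmod h <= d)%R -> f (x + h) = g (x + h)) ->
  is_Cderive f x l -> is_Cderive g x l.
Proof.
  intros Hd E (d' & K & Hd' & H).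
  exists (Rmin d d'), K; split; [now apply Rmin_case|].
  intros h Hh.
  assert (E0 := E (RtoC 0)); rewrite Cmod_0, Cplus_0_r in E0.
  rewrite <- E by (eapply Rle_trans; [exact Hh | apply Rmin_l]).
  rewrite <- E0 by lra.
  apply H; eapply Rle_trans; [exact Hh | apply Rmin_r].
Qed.

Lemma is_Cderive_id (x : C) : is_Cderive (fun y => y) x (RtoC 1).
Proof.
  exists 1%R, 0%R; split; [lra|]; intros h _.
  replace (x + h - x - h * RtoC 1) with (RtoC 0) by ring.
  rewrite Cmod_0; lra.
Qed.

Lemma is_Cderive_comp_shift (f : C -> C) (a x l : C) :
  is_Cderive f (x + a) l -> is_Cderive (fun y => f (y + a)) x l.
Proof.
  intros (d & K & Hd & H); exists d, K; split; [exact Hd|]; intros h Hh.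
  replace (x + h + a) with (x + a + h) by ring; now apply H.
Qed.

Lemma is_Cderive_mult (f g : C -> C) (x lf lg : C) :
  is_Cderive f x lf -> is_Cderive g x lg ->
  is_Cderive (fun y => f y * g y) x (lf * g x + f x * lg).
Proof.
  intros (d1 & K1 & Hd1 & H1) (d2 & K2 & Hd2 & H2).
  (* [G] bounds g(x+h): the radius is at most 1, so |h|^2 <= |h| <= 1. *)
  set (G := (Cmod (g x) + Cmod lg + Rabs K2)%R).
  exists (Rmin 1 (Rmin d1 d2)),
    (Rabs K1 * G + Cmod lf * (Cmod lg + Rabs K2) + Cmod (f x) * Rabs K2)%R.
  split; [repeat apply Rmin_case; lra|].
  intros h Hh.
  assert (L1 := Rle_trans _ _ _ Hh (Rmin_l _ _)).
  assert (L0 := Rle_trans _ _ _ Hh (Rmin_r _ _)).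
  specialize (H1 h (Rle_trans _ _ _ L0 (Rmin_l _ _))).
  specialize (H2 h (Rle_trans _ _ _ L0 (Rmin_r _ _))).
  set (hh := Cmod h) in *.
  assert (P0 : (0 <= hh)%R) by apply Cmod_ge_0.
  assert (A1 := Rle_abs K1); assert (A2 := Rle_abs K2).
  assert (B1 : (Cmod (f (x + h)%C - f x - h * lf) <= Rabs K1 * (hh * hh))%R) by nra.
  assert (B2 : (Cmod (g (x + h)%C - g x - h * lg) <= Rabs K2 * (hh * hh))%R) by nra.
  assert (B3 : (Cmod (g (x + h)%C - g x) <= hh * (Cmod lg + Rabs K2))%R).
  { replace (g (x + h)%C - g x) with ((g (x + h)%C - g x - h * lg) + h * lg) by ring.
    eapply Rle_trans; [apply Cmod_triangle|]. rewrite Cmod_mult; fold hh.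
    assert (Q := Rmult_le_pos _ _ (Rmult_le_pos _ _ (Rabs_pos K2) P0)
                   (proj1 (Rminus_le_0 _ _) L1)).
    lra. }
  assert (B4 : (Cmod (g (x + h)%C) <= G)%R).
  { replace (g (x + h)) with (g x + (g (x + h)%C - g x)) by ring.
    eapply Rle_trans; [apply Cmod_triangle|]. unfold G.
    assert (Q := Rabs_pos K2); assert (Q' := Cmod_ge_0 lg). nra. }
  (* Remainder of f against g(x+h), slope of f against the increment of g, and f(x) against the
     remainder of g: one summand of the constant for each. *)
  replace (f (x + h) * g (x + h) - f x * g x - h * (lf * g x + f x * lg))
    with ((f (x + h)%C - f x - h * lf) * g (x + h) + h * lf * (g (x + h)%C - g x)
          + f x * (g (x + h)%C - g x - h * lg)) by ring.
  eapply Rle_trans; [apply Cmod_triangle|].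
  eapply Rle_trans; [apply Rplus_le_compat_r, Cmod_triangle|].
  rewrite !Cmod_mult; fold hh.
  rewrite !Rmult_plus_distr_r; repeat apply Rplus_le_compat.
  - replace (Rabs K1 * G * (hh * hh))%R with (Rabs K1 * (hh * hh) * G)%R by ring.
    apply Rmult_le_compat; auto using Cmod_ge_0.
  - replace (Cmod lf * (Cmod lg + Rabs K2) * (hh * hh))%R
      with (hh * Cmod lf * (hh * (Cmod lg + Rabs K2)))%R by ring.
    apply Rmult_le_compat_l; [apply Rmult_le_pos; [exact P0 | apply Cmod_ge_0] | exact B3].
  - rewrite Rmult_assoc; apply Rmult_le_compat_l; [apply Cmod_ge_0 | exact B2].
Qed.

Lemma Cmod_add_ge (x y : C) : (Cmod x - Cmod y <= Cmod (x + y))%R.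
Proof.
  assert (H := Cmod_triangle (x + y) (- y)).
  replace (x + y + - y) with x in H by ring. rewrite Cmod_opp in H; lra.
Qed.

Lemma is_Cderive_inv (x : C) :
  x <> RtoC 0 -> is_Cderive (fun y => / y) x (- / (x * x)).
Proof.
  intros Hx; assert (Px := proj1 (Cmod_gt_0 _) Hx).
  (* The remainder is exactly h^2 / (x^2 (x+h)), and |x+h| >= |x|/2 on this disc. *)
  exists (Cmod x / 2)%R, (/ (Cmod x * Cmod x * (Cmod x / 2)))%R; split; [lra|].
  intros h Hh.
  assert (L : (Cmod x / 2 <= Cmod (x + h))%R) by (assert (Q := Cmod_add_ge x h); lra).
  assert (Hxh : x + h <> RtoC 0) by (apply Cmod_gt_0; lra).
  replace (/ (x + h) - / x - h * - / (x * x))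
    with (h * h / (x * x * (x + h))) by (field; auto).
  rewrite Cmod_div by (repeat apply Cmult_neq_0; auto).
  rewrite (Cmod_mult h h), (Cmod_mult (x * x)), (Cmod_mult x x); unfold Rdiv at 1; rewrite Rmult_comm.
  apply Rmult_le_compat_r; [apply Rmult_le_pos; apply Cmod_ge_0|].
  assert (0 < Cmod x * Cmod x)%R by now apply Rmult_lt_0_compat.
  apply Rinv_le_contravar; [apply Rmult_lt_0_compat; lra|].
  apply Rmult_le_compat_l; [lra | exact L].
Qed.

(** * The Gamma function *)

Lemma nonpos_int_shift (x : C) (k : nat) :
  ~ nonpos_int x -> ~ nonpos_int (x + RtoC (INR k)).
Proof.
  intros H [n Hn]; apply H; exists (n + k)%nat.
  replace x with ((x + RtoC (INR k)) - RtoC (INR k)) by ring.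
  rewrite Hn, plus_INR, <- RtoC_minus; f_equal; ring.
Qed.

Lemma add_INR_neq_0 (x : C) (n : nat) :
  ~ nonpos_int x -> x + RtoC (INR n) <> RtoC 0.
Proof.
  intros H E; apply H; exists n.
  replace x with ((x + RtoC (INR n)) - RtoC (INR n)) by ring.
  rewrite E, <- RtoC_minus; f_equal; ring.
Qed.

Lemma neq_0_of_not_nonpos_int (x : C) : ~ nonpos_int x -> x <> RtoC 0.
Proof. intros H E; apply H; exists O; rewrite E; f_equal; simpl; ring. Qed.

Lemma Cmod_INR (n : nat) : Cmod (RtoC (INR n)) = INR n.
Proof. rewrite Cmod_R, Rabs_pos_eq; auto using pos_INR. Qed.

Lemma INR_S_neq_0 (n : nat) : RtoC (INR (S n)) <> RtoC 0.
Proof. apply Cmod_gt_0; rewrite Cmod_INR; apply INR_S_pos. Qed.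

(** For n >= 2|x| + 1 the triangle inequality gives |x+n| >= n - |x| >= (n+1)/2; the finitely many
    smaller n contribute a positive minimum. The bound turns every 1/(x+n) into O(1/(n+1)) with an
    explicit constant. *)
Lemma pole_distance (x : C) :
  ~ nonpos_int x ->
  exists k : R, (0 < k)%R /\
    forall n, (k * INR (S n) <= Cmod (x + RtoC (INR n)))%R.
Proof.
  intros Hx.
  assert (Hfin : forall N, exists k : R, (0 < k <= / 2)%R /\
            forall n, (n < N)%nat -> (k * INR (S n) <= Cmod (x + RtoC (INR n)))%R).
  { intro N; induction N as [|N [k [Hk IH]]].
    - exists (/ 2)%R; split; [lra | intros; lia].
    - assert (P := proj1 (Cmod_gt_0 _) (add_INR_neq_0 x N Hx)).
      assert (PN := INR_S_pos N).
      exists (Rmin k (Cmod (x + RtoC (INR N)) / INR (S N))); split; [split|].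
      + apply Rmin_case; [lra | now apply Rdiv_lt_0_compat].
      + eapply Rle_trans; [apply Rmin_l | lra].
      + intros n Hn; assert (Pn := INR_S_pos n).
        destruct (Nat.eq_dec n N) as [-> | Hne].
        * eapply Rle_trans; [apply Rmult_le_compat_r; [lra | apply Rmin_r]|].
          right; field; lra.
        * eapply Rle_trans; [apply Rmult_le_compat_r; [lra | apply Rmin_l]|].
          apply IH; lia. }
  destruct (INR_unbounded (2 * Cmod x + 1)) as [N HN].
  destruct (Hfin N) as [k [Hk H]]; exists k; split; [lra|]; intro n.
  destruct (Compare_dec.lt_dec n N) as [Hn | Hn]; [now apply H|].
  assert (L : (INR N <= INR n)%R) by (apply le_INR; lia).
  assert (Q := Cmod_add_ge (RtoC (INR n)) x).
  rewrite Cmod_INR, Cplus_comm in Q.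
  assert (P := pos_INR n); rewrite S_INR; nra.
Qed.

(* As Stdlib's [ln 0] is [0], the term [n = 0] is [0] and products over all [n] make sense. *)
Definition ln_step (n : nat) : R := (ln (INR (S n)) - ln (INR n))%R.

Lemma ln_le_sub_1 (y : R) : (0 < y -> ln y <= y - 1)%R.
Proof.
  intros Hy; assert (H := exp_ineq1_le (ln y)); rewrite exp_ln in H; lra.
Qed.

Lemma ln_INR_0 : ln (INR 0) = 0%R.
Proof. simpl; unfold ln; destruct (Rlt_dec 0 0) as [H|_]; [destruct (Rlt_irrefl _ H) | reflexivity]. Qed.

(** For n >= 1 both 1/(n+1) <= ln((n+1)/n) <= 1/n come from ln y <= y - 1, and 1/n <= 2/(n+1). At n
    = 0 the step is 0 and the constants 2 leave room for it. *)
Lemma ln_step_bounds (n : nat) :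
  (0 <= ln_step n <= 2 * / INR (S n) /\
   Rabs (ln_step n - / INR (S n)) <= 2 * (/ INR (S n) * / INR (S n)))%R.
Proof.
  destruct n as [|n].
  - unfold ln_step; rewrite ln_INR_0; rewrite INR_1, ln_1, Rinv_1.
    split; [lra|]. rewrite Rabs_left; lra.
  - assert (Pn := INR_S_pos n); assert (PSn := INR_S_pos (S n)).
    assert (U : (ln_step (S n) <= / INR (S n))%R).
    { unfold ln_step; rewrite <- ln_div by assumption.
      eapply Rle_trans; [apply ln_le_sub_1; now apply Rdiv_lt_0_compat|].
      rewrite (S_INR (S n)); right; field; lra. }
    assert (L : (/ INR (S (S n)) <= ln_step (S n))%R).
    { unfold ln_step. rewrite <- Ropp_minus_distr, <- ln_div by assumption.
      assert (Q := ln_le_sub_1 (INR (S n) / INR (S (S n))) ltac:(now apply Rdiv_lt_0_compat)).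
      replace (INR (S n) / INR (S (S n)) - 1)%R with (- / INR (S (S n)))%R in Q; [lra|].
      rewrite (S_INR (S n)) in *; field; lra. }
    assert (G := inv_INR_S_pos (S n)).
    assert (T : (/ INR (S n) <= 2 * / INR (S (S n)))%R).
    { apply Rmult_le_reg_r with (INR (S n) * INR (S (S n)))%R; [nra|].
      assert (1 <= INR (S n))%R by (rewrite S_INR; assert (Q := pos_INR n); lra).
      rewrite (S_INR (S n)) in *; field_simplify; lra. }
    split; [lra|].
    rewrite Rabs_pos_eq by lra.
    assert (E : (/ INR (S n) - / INR (S (S n)) = / INR (S n) * / INR (S (S n)))%R)
      by (rewrite (S_INR (S n)) in *; field; lra).
    nra.
Qed.

(* The quotient of two consecutive terms of Euler's sequence at [x + h],
   divided by the same quotient at [x]. *)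
Definition euler_ratio (x h : C) (n : nat) : C :=
  Cexp (h * RtoC (ln_step n)) * ((x + RtoC (INR (S n))) / (x + h + RtoC (INR (S n)))).

(** The h-derivative of [euler_ratio x h n] at h = 0. The partial sums are ln n - (1/(x+1) + ... +
    1/(x+n)), whose limit is the logarithmic derivative of x Gamma(x), that is, psi(x+1). *)
Definition euler_slope (x : C) (n : nat) : C :=
  RtoC (ln_step n) - / (x + RtoC (INR (S n))).

Lemma euler_slope_bound (x : C) (k : R) (n : nat) :
  (0 < k)%R -> (k * INR (S n) <= Cmod (x + RtoC (INR (S n))))%R ->
  (Cmod (euler_slope x n) <= 2 * (2 + Cmod x / k) * tele n)%R.
Proof.
  intros Hk Hy; unfold euler_slope.
  set (y := x + RtoC (INR (S n))) in *; set (N := INR (S n)) in *.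
  assert (PN : (0 < N)%R) by apply INR_S_pos.
  assert (Hy0 : y <> RtoC 0) by (apply Cmod_gt_0; nra).
  assert (HN0 : RtoC N <> RtoC 0) by apply INR_S_neq_0.
  (* Comparison with 1/N: the difference 1/N - 1/y equals x / (N y), so both summands are
     O(1/N^2). *)
  replace (RtoC (ln_step n) - / y) with ((RtoC (ln_step n) - RtoC (/ N)) + x / (RtoC N * y)).
  2: { rewrite RtoC_inv by lra. unfold y, N in *; field; auto. }
  eapply Rle_trans; [apply Cmod_triangle|].
  rewrite <- RtoC_minus, Cmod_R, Cmod_div by (now apply Cmult_neq_0).
  rewrite Cmod_mult, Cmod_R, (Rabs_pos_eq N) by lra.
  destruct (ln_step_bounds n) as [_ B]; fold N in B.
  assert (T := inv_sqr_le_tele n); fold N in T.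
  assert (Q : (Cmod x / (N * Cmod y) <= Cmod x / k * (/ N * / N))%R).
  { replace (Cmod x / k * (/ N * / N))%R with (Cmod x * / (N * (k * N)))%R by (field; lra).
    apply Rmult_le_compat_l; [apply Cmod_ge_0|].
    apply Rinv_le_contravar;
      [repeat apply Rmult_lt_0_compat; lra | apply Rmult_le_compat_l; lra]. }
  assert (P : (0 <= Cmod x / k)%R) by (apply Rdiv_le_0_compat; [apply Cmod_ge_0 | lra]).
  nra.
Qed.

(** Expanding exp(hl) to first order and y/(y+h) as 1 - h/(y+h), the linear terms cancel and three
    remainders of order |h|^2/N^2 are left. The 16 is the 4 of [Cexp_bound2] times the square of l
    <= 2/N, the outer 2 comes from comparing 1/N^2 with [tele], and [H] makes the constant uniform
    in h. *)
Lemma euler_ratio_bound (x h : C) (k H : R) (n : nat) :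
  (0 < k)%R -> (Cmod h <= H)%R ->
  (k * INR (S n) <= Cmod (x + RtoC (INR (S n))))%R ->
  (k * INR (S n) <= Cmod (x + h + RtoC (INR (S n))))%R ->
  (Cmod (euler_ratio x h n - RtoC 1 - h * euler_slope x n)
   <= Cmod h * Cmod h *
      (2 * (16 * exp (2 * H) * (1 + H / k) + 2 / k + / (k * k))) * tele n)%R.
Proof.
  intros Hk HH Hy Hyh; unfold euler_ratio, euler_slope.
  replace (x + h + RtoC (INR (S n))) with (x + RtoC (INR (S n)) + h) in * by ring.
  set (y := x + RtoC (INR (S n))) in *; set (N := INR (S n)) in *.
  assert (PN : (1 <= N)%R) by (unfold N; rewrite S_INR; assert (Q := pos_INR n); lra).
  assert (Hy0 : y <> RtoC 0) by (apply Cmod_gt_0; nra).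
  assert (Hyh0 : y + h <> RtoC 0) by (apply Cmod_gt_0; nra).
  destruct (ln_step_bounds n) as [[L0 L1] _]; fold N in L1.
  set (l := ln_step n) in *.
  set (rho := Cexp (h * RtoC l) - RtoC 1 - h * RtoC l).
  replace (Cexp (h * RtoC l) * (y / (y + h)) - RtoC 1 - h * (RtoC l - / y))
    with (rho * (y / (y + h)) + (- (h * h) * RtoC l / (y + h) + h * h / (y * (y + h))))
    by (unfold rho; field; auto).
  assert (Ph := Cmod_ge_0 h).
  assert (PiN : (0 < / N)%R) by (apply Rinv_0_lt_compat; lra).
  assert (iN1 : (/ N <= 1)%R) by (rewrite <- Rinv_1; apply Rinv_le_contravar; lra).
  assert (I1 : (/ Cmod y <= / k * / N)%R).
  { rewrite <- Rinv_mult; apply Rinv_le_contravar; [nra | exact Hy]. }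
  assert (I2 : (/ Cmod (y + h) <= / k * / N)%R).
  { rewrite <- Rinv_mult; apply Rinv_le_contravar; [nra | exact Hyh]. }
  assert (Pk : (0 < / k)%R) by now apply Rinv_0_lt_compat.
  assert (J1 : (0 < / Cmod y)%R) by (apply Rinv_0_lt_compat; nra).
  assert (J2 : (0 < / Cmod (y + h))%R) by (apply Rinv_0_lt_compat; nra).
  assert (Bq : (Cmod (y / (y + h)) <= 1 + H / k)%R).
  { replace (y / (y + h)) with (RtoC 1 + - h / (y + h)) by (field; auto).
    eapply Rle_trans; [apply Cmod_triangle|].
    rewrite Cmod_1, Cmod_div, Cmod_opp by auto.
    apply Rplus_le_compat_l; apply Rmult_le_compat; try lra. nra. }
  assert (Brho : (Cmod rho <= Cmod h * Cmod h * (16 * exp (2 * H)) * (/ N * / N))%R).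
  { unfold rho; eapply Rle_trans; [apply Cexp_bound2|].
    rewrite Cmod_mult, Cmod_R, (Rabs_pos_eq l) by exact L0.
    assert (E : (exp (Cmod h * l) <= exp (2 * H))%R) by (apply exp_le; nra).
    assert (X := exp_pos (Cmod h * l)).
    assert (Y : (l * l <= 4 * (/ N * / N))%R) by nra.
    assert (Y0 : (0 <= l * l)%R) by nra.
    assert (W : (l * l * exp (Cmod h * l) <= 4 * (/ N * / N) * exp (2 * H))%R)
      by (apply Rmult_le_compat; lra).
    assert (Z : (0 <= Cmod h * Cmod h)%R) by nra.
    replace (4 * (Cmod h * l * (Cmod h * l) * exp (Cmod h * l)))%R
      with (4 * (Cmod h * Cmod h) * (l * l * exp (Cmod h * l)))%R by ring.
    replace (Cmod h * Cmod h * (16 * exp (2 * H)) * (/ N * / N))%R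
      with (4 * (Cmod h * Cmod h) * (4 * (/ N * / N) * exp (2 * H)))%R by ring.
    apply Rmult_le_compat_l; lra. }
  eapply Rle_trans; [apply Cmod_triangle|].
  eapply Rle_trans; [apply Rplus_le_compat_l, Cmod_triangle|].
  rewrite Cmod_mult, (Cmod_div (- (h * h) * _)), (Cmod_div (h * h)) by auto using Cmult_neq_0.
  rewrite (Cmod_mult (- (h * h))), Cmod_opp, (Cmod_mult h h), Cmod_R, (Rabs_pos_eq l),
    (Cmod_mult y) by exact L0.
  set (hh := (Cmod h * Cmod h)%R) in *.
  assert (Phh : (0 <= hh)%R) by (unfold hh; nra).
  apply Rle_trans with (hh * (16 * exp (2 * H) * (1 + H / k) + 2 / k + / (k * k)) * (/ N * / N))%R.
  - replace (hh * (16 * exp (2 * H) * (1 + H / k) + 2 / k + / (k * k)) * (/ N * / N))%R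
      with (hh * (16 * exp (2 * H)) * (/ N * / N) * (1 + H / k)
            + (hh * (2 * / N) * (/ k * / N) + hh * ((/ k * / N) * (/ k * / N))))%R
      by (field; lra).
    repeat apply Rplus_le_compat.
    + apply Rmult_le_compat; auto using Cmod_ge_0.
    + apply Rmult_le_compat; [nra | lra | apply Rmult_le_compat_l; lra | exact I2].
    + apply Rmult_le_compat_l; [exact Phh|].
      rewrite Rinv_mult; apply Rmult_le_compat; lra.
  - assert (T := inv_sqr_le_tele n); fold N in T.
    set (A := (16 * exp (2 * H) * (1 + H / k) + 2 / k + / (k * k))%R).
    assert (PA : (0 <= A)%R).
    { unfold A. assert (X := exp_pos (2 * H)).
      assert (0 <= H / k)%R by (apply Rdiv_le_0_compat; lra).
      assert (0 < / (k * k))%R by (apply Rinv_0_lt_compat; nra).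
      assert (0 <= 2 / k)%R by (apply Rdiv_le_0_compat; lra). nra. }
    replace (hh * (2 * A) * tele n)%R with (hh * A * (2 * tele n))%R by ring.
    apply Rmult_le_compat_l; [nra | exact T].
Qed.

Lemma pole_distance_S (x : C) :
  ~ nonpos_int x ->
  exists k : R, (0 < k)%R /\
    forall n, (k * INR (S n) <= Cmod (x + RtoC (INR (S n))))%R.
Proof.
  intros Hx; destruct (pole_distance x Hx) as [k [Hk H]].
  exists k; split; [exact Hk|]; intro n.
  eapply Rle_trans; [|apply H]; rewrite (S_INR (S n)); nra.
Qed.

Lemma ex_Clim_cprod_euler (x h : C) (k : R) :
  (0 < k)%R ->
  (forall n, k * INR (S n) <= Cmod (x + RtoC (INR (S n))))%R ->
  (forall n, k * INR (S n) <= Cmod (x + h + RtoC (INR (S n))))%R ->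
  exists l, Clim (cprod (euler_ratio x h)) l.
Proof.
  intros Hk H1 H2.
  eapply ex_Clim_cprod; intro n.
  replace (euler_ratio x h n - RtoC 1)
    with ((euler_ratio x h n - RtoC 1 - h * euler_slope x n) + h * euler_slope x n) by ring.
  eapply Rle_trans; [apply Cmod_triangle|].
  rewrite Cmod_mult.
  eapply Rle_trans.
  - apply Rplus_le_compat.
    + apply (euler_ratio_bound x h k (Cmod h)); auto; lra.
    + apply Rmult_le_compat_l; [apply Cmod_ge_0|].
      apply (euler_slope_bound x k); auto.
  - rewrite <- (Rmult_assoc (Cmod h) _ (tele n)), <- Rmult_plus_distr_r; apply Rle_refl.
Qed.

Lemma rising_neq_0 (x : C) (n : nat) : ~ nonpos_int x -> rising x n <> RtoC 0.
Proof.
  intros Hx; induction n as [|n IH]; simpl.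
  - intro E; apply RtoC_inj in E; lra.
  - apply Cmult_neq_0; [exact IH | now apply add_INR_neq_0].
Qed.

Lemma INR_fact_neq_0 (n : nat) : RtoC (INR (fact n)) <> RtoC 0.
Proof. intro E; apply RtoC_inj in E; exact (INR_fact_neq_0 n E). Qed.

Lemma Cpower_INR (n : nat) (x : C) :
  (0 < n)%nat -> Cpower (RtoC (INR n)) x = Cexp (x * RtoC (ln (INR n))).
Proof.
  intros Hn; unfold Cpower, Clog, Carg; f_equal; f_equal.
  rewrite Cmod_INR; apply C_eq; simpl; [reflexivity|].
  destruct (Rle_dec 0 0) as [_|H]; [|lra].
  unfold Rdiv; rewrite Rinv_r; [apply acos_1 | apply not_0_INR; lia].
Qed.

(** With base point 0 the factor [euler_ratio 0 x n] is the plain quotient of consecutive Euler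
    terms at x. The convention ln 0 = 0 makes the term of index 0 equal to 1/x. *)
Lemma euler_sequence_eq (x : C) (n : nat) :
  ~ nonpos_int x ->
  RtoC (INR (fact n)) * Cexp (x * RtoC (ln (INR n))) / rising x (S n)
  = / x * cprod (euler_ratio (RtoC 0) x) n.
Proof.
  intros Hx; assert (Hx0 := neq_0_of_not_nonpos_int x Hx).
  induction n as [|n IH].
  - rewrite ln_INR_0; simpl.
    rewrite Cmult_0_r, Cexp_0, Cplus_0_r; field; exact Hx0.
  - change (cprod ?f (S n)) with (cprod f n * f n).
    rewrite Cmult_assoc, <- IH; unfold euler_ratio.
    replace (x * RtoC (ln (INR (S n))))
      with (x * RtoC (ln (INR n)) + x * RtoC (ln_step n))
      by (unfold ln_step; rewrite RtoC_minus; ring).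
    rewrite Cexp_plus.
    change (fact (S n)) with (S n * fact n)%nat.
    rewrite mult_INR, RtoC_mult.
    change (rising x (S (S n))) with (rising x (S n) * (x + RtoC (INR (S n)))).
    replace (RtoC 0 + x + RtoC (INR (S n))) with (x + RtoC (INR (S n))) by ring.
    assert (A := rising_neq_0 x (S n) Hx); assert (B := add_INR_neq_0 x (S n) Hx).
    field; auto.
Qed.

Lemma euler_ratio_inv (x : C) (n : nat) :
  ~ nonpos_int x -> euler_ratio (RtoC 0) x n * euler_ratio x (- x) n = RtoC 1.
Proof.
  intros Hx; unfold euler_ratio.
  replace (x + - x) with (RtoC 0) by ring.
  replace (RtoC 0 + x) with x by ring; replace (RtoC 0 + RtoC (INR (S n))) with (RtoC (INR (S n))) by ring.
  replace (- x * RtoC (ln_step n)) with (- (x * RtoC (ln_step n))) by ring.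
  assert (A := Cexp_opp_mult (x * RtoC (ln_step n))).
  assert (B := add_INR_neq_0 x (S n) Hx); assert (D := INR_S_neq_0 n).
  rewrite Cmult_comm in A. rewrite <- A; field; auto.
Qed.

(** Cocycle rule: the way from 0 to x+h leads through x. In the limit it expresses (x+h) Gamma(x+h)
    as x Gamma(x) times a product depending on h, the form in which both the functional equation and
    the derivative are obtained. *)
Lemma euler_ratio_comp (x h : C) (n : nat) :
  ~ nonpos_int x ->
  euler_ratio (RtoC 0) (x + h) n = euler_ratio (RtoC 0) x n * euler_ratio x h n.
Proof.
  intros Hx; unfold euler_ratio.
  rewrite Cmult_plus_distr_r, Cexp_plus.
  replace (RtoC 0 + (x + h)) with (x + h) by ring; replace (RtoC 0 + x) with x by ring.
  unfold Cdiv; rewrite <- (Cmult_1_r (RtoC 0 + RtoC (INR (S n)))) at 1.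
  rewrite <- (Cinv_l (x + RtoC (INR (S n)))) by (now apply add_INR_neq_0).
  ring.
Qed.

Lemma cprod_mult (f g h : nat -> C) :
  (forall n, h n = f n * g n) -> forall n, cprod h n = cprod f n * cprod g n.
Proof.
  intros E n; induction n as [|n IH]; simpl; [ring|]. rewrite IH, E; ring.
Qed.

Lemma Gamma_Clim (x : C) :
  ~ nonpos_int x -> Clim (cprod (euler_ratio (RtoC 0) x)) (x * Gamma x).
Proof.
  intros Hx; assert (Hx0 := neq_0_of_not_nonpos_int x Hx).
  destruct (pole_distance_S x Hx) as [k [Hk H]].
  (* The base point 0 admits the constant 1, the point x the constant k. *)
  destruct (ex_Clim_cprod_euler (RtoC 0) x (Rmin k 1)) as [l Hl].
  - now apply Rmin_case; [|lra].
  - intro n; rewrite Cplus_0_l, Cmod_INR; assert (P := INR_S_pos n).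
    assert (M := Rmin_r k 1); nra.
  - intro n; rewrite Cplus_0_l; eapply Rle_trans; [|apply H].
    apply Rmult_le_compat_r; [left; apply INR_S_pos | apply Rmin_l].
  - assert (E : Gamma x = / x * l).
    { apply Clim_CLim_seq.
      (* From index 1 on the base [INR n] of the power is positive, so its principal argument is
         0. *)
      eapply (Clim_ext_loc _ _ _ 1); [|apply Clim_scal, Hl].
      intros n Hn; rewrite Cpower_INR by lia; symmetry; now apply euler_sequence_eq. }
    rewrite E; replace (x * (/ x * l)) with l by (field; exact Hx0); exact Hl.
Qed.

(** The product of the inverse factors, leading from x back to 0, converges as well; the two limits
    multiply to 1, so neither can vanish. *)
Lemma Gamma_neq_0 (x : C) : ~ nonpos_int x -> Gamma x <> RtoC 0.
Proof.
  intros Hx E; assert (L := Gamma_Clim x Hx).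
  destruct (pole_distance_S x Hx) as [k [Hk H]].
  destruct (ex_Clim_cprod_euler x (- x) (Rmin k 1)) as [l Hl].
  - now apply Rmin_case; [|lra].
  - intro n; eapply Rle_trans; [|apply H].
    apply Rmult_le_compat_r; [left; apply INR_S_pos | apply Rmin_l].
  - intro n; replace (x + - x) with (RtoC 0) by ring.
    rewrite Cplus_0_l, Cmod_INR; assert (P := INR_S_pos n).
    assert (M := Rmin_r k 1); nra.
  - assert (U := Clim_mult _ _ _ _ L Hl).
    apply (Clim_ext_loc _ (fun _ => RtoC 1) _ O) in U.
    + assert (V := Clim_unique _ _ _ U (Clim_const (RtoC 1))).
      rewrite E in V; replace (x * RtoC 0 * l) with (RtoC 0) in V by ring.
      apply RtoC_inj in V; lra.
    + intros n _.
      rewrite <- (cprod_mult _ _ (fun _ => RtoC 1)).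
      * induction n as [|n IH]; simpl; [reflexivity | rewrite IH; ring].
      * intro m; symmetry; now apply euler_ratio_inv.
Qed.

Lemma Clim_0_of_bound (u : nat -> C) (K : R) :
  (forall n, Cmod (u n) <= K * / INR (S n))%R -> Clim u (RtoC 0).
Proof.
  intros H.
  assert (L : is_lim_seq (fun n => K * / INR (S n))%R 0%R).
  { replace 0%R with (K * 0)%R by ring.
    apply is_lim_seq_mult'; [apply is_lim_seq_const|].
    apply (is_lim_seq_incr_1 (fun n => / INR n)%R 0%R).
    apply (is_lim_seq_inv _ p_infty); [apply is_lim_seq_INR | easy]. }
  split; apply is_lim_seq_abs_0; eapply is_lim_seq_le_le;
    [|apply is_lim_seq_const|exact L| |apply is_lim_seq_const|exact L];
    intro n; (split; [apply Rabs_pos|]); (eapply Rle_trans; [|apply H]).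
  - apply re_le_Cmod.
  - apply im_le_Cmod.
Qed.

(** For h = 1 and n >= 1 the exponential factor is (n+1)/n and everything telescopes. The closed
    form starts at index [S n] because the factor of index 0 has [ln_step 0] = 0. The limit is read
    off from n/(x+n+1) = 1 - (x+1)/(x+n+1). *)
Lemma cprod_euler_ratio_1 (x : C) :
  ~ nonpos_int x -> Clim (cprod (euler_ratio x (RtoC 1))) (x + RtoC 1).
Proof.
  intros Hx.
  assert (E : forall n, cprod (euler_ratio x (RtoC 1)) (S n)
               = (x + RtoC 1) * (RtoC (INR (S n)) / (x + RtoC (INR (S (S n)))))).
  { assert (Hd : forall n, x + RtoC 1 + RtoC (INR n) <> RtoC 0).
    { intro n; replace (x + RtoC 1 + RtoC (INR n)) with (x + RtoC (INR (S n)))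
        by (rewrite S_INR, RtoC_plus; ring). now apply add_INR_neq_0. }
    assert (Ee : forall n, RtoC (INR n) = Cexp (RtoC 1 * RtoC (ln (INR n))) \/ n = O).
    { intros [|n]; [now right | left].
      rewrite Cmult_1_l, Cexp_RtoC, exp_ln; [reflexivity | apply INR_S_pos]. }
    intro n; induction n as [|n IH].
    - simpl cprod; unfold euler_ratio, ln_step.
      rewrite ln_INR_0, INR_1, ln_1, Rminus_0_r, Cmult_0_r, Cexp_0, !Cmult_1_l.
      unfold Cdiv; rewrite Cmult_1_l; do 2 f_equal.
      rewrite S_INR, INR_1, RtoC_plus; ring.
    - change (cprod ?f (S (S n))) with (cprod f (S n) * f (S n)).
      rewrite IH; unfold euler_ratio.
      replace (x + RtoC 1 + RtoC (INR (S (S n)))) with (x + RtoC (INR (S (S (S n)))))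
        by (rewrite (S_INR (S (S n))), RtoC_plus; ring).
      assert (A := add_INR_neq_0 x (S (S n)) Hx).
      assert (B := add_INR_neq_0 x (S (S (S n))) Hx).
      destruct (Ee (S n)) as [E1|]; [|discriminate].
      destruct (Ee (S (S n))) as [E2|]; [|discriminate].
      assert (E3 : Cexp (RtoC 1 * RtoC (ln_step (S n))) * RtoC (INR (S n)) = RtoC (INR (S (S n)))).
      { rewrite E1, E2, <- Cexp_plus; f_equal; unfold ln_step; rewrite RtoC_minus; ring. }
      set (y := x + RtoC (INR (S (S n)))) in *; set (y' := x + RtoC (INR (S (S (S n))))) in *.
      rewrite <- E3; field; auto. }
  destruct (pole_distance_S x Hx) as [k [Hk H]].
  assert (Z : Clim (fun n => / (x + RtoC (INR (S n)))) (RtoC 0)).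
  { apply Clim_0_of_bound with (/ k)%R; intro n.
    rewrite Cmod_inv by (now apply add_INR_neq_0).
    rewrite <- Rinv_mult; apply Rinv_le_contravar; [|apply H].
    apply Rmult_lt_0_compat; [exact Hk | apply INR_S_pos]. }
  assert (W := Clim_scal (- (x + RtoC 1) * (x + RtoC 1)) _ _ Z).
  assert (V := Clim_plus _ _ _ _ (Clim_const (x + RtoC 1)) W).
  rewrite Cmult_0_r, Cplus_0_r in V.
  eapply (Clim_ext_loc _ _ _ 1); [|exact V].
  intros [|n] Hn; [lia|]; rewrite E.
  assert (A := add_INR_neq_0 x (S (S n)) Hx).
  replace (RtoC (INR (S n))) with (x + RtoC (INR (S (S n))) - (x + RtoC 1))
    by (rewrite (S_INR (S n)), RtoC_plus; ring).
  field; exact A.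
Qed.

Lemma Gamma_S (x : C) : ~ nonpos_int x -> Gamma (x + RtoC 1) = x * Gamma x.
Proof.
  intros Hx.
  assert (Hx1 : ~ nonpos_int (x + RtoC 1)).
  { rewrite <- INR_1; now apply nonpos_int_shift. }
  assert (A := Gamma_Clim _ Hx1).
  assert (B := Clim_mult _ _ _ _ (Gamma_Clim _ Hx) (cprod_euler_ratio_1 x Hx)).
  apply (Clim_ext_loc _ (cprod (euler_ratio (RtoC 0) (x + RtoC 1))) _ O) in B.
  - assert (D := Clim_unique _ _ _ A B).
    assert (N := neq_0_of_not_nonpos_int _ Hx1).
    replace (Gamma (x + RtoC 1)) with ((x + RtoC 1) * Gamma (x + RtoC 1) / (x + RtoC 1))
      by (field; exact N).
    rewrite D; field; exact N.
  - intros n _; symmetry; apply cprod_mult; intro m; now apply euler_ratio_comp.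
Qed.

Lemma csum_scal (a : C) (f : nat -> C) (n : nat) :
  csum (fun k => a * f k) n = a * csum f n.
Proof. induction n as [|n IH]; simpl; [ring | rewrite IH; ring]. Qed.

(** Half the constant at x is given up to absorb h. A constant valid on a whole disc keeps the
    remainder of Gamma uniform in h. *)
Lemma pole_distance_nearby (x : C) :
  ~ nonpos_int x ->
  exists k : R, (0 < k)%R /\ forall h, (Cmod h <= k)%R ->
    ~ nonpos_int (x + h) /\ forall n, (k * INR (S n) <= Cmod (x + h + RtoC (INR n)))%R.
Proof.
  intros Hx; destruct (pole_distance x Hx) as [k [Hk H]].
  assert (Hxh : forall h n, (Cmod h <= k / 2)%R ->
            (k / 2 * INR (S n) <= Cmod (x + h + RtoC (INR n)))%R).
  { intros h n Hh.
    replace (x + h + RtoC (INR n)) with (x + RtoC (INR n) + h) by ring.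
    assert (Q := Cmod_add_ge (x + RtoC (INR n)) h); specialize (H n).
    assert (W := INR_S_ge_1 n); nra. }
  exists (k / 2)%R; split; [lra|]; intros h Hh; split; [|now intro n; apply Hxh].
  intros [n Hn]; specialize (Hxh h n Hh).
  rewrite Hn, <- RtoC_plus, Rplus_opp_l, Cmod_0 in Hxh.
  assert (P := INR_S_pos n); nra.
Qed.

(** For F(y) = y Gamma(y), the quotient F(x+h)/F(x) is an infinite product whose partial products
    are 1 + h (sum of slopes) + O(h^2) by [cprod_expansion], uniformly in n. The limit keeps the
    bound, so F'(x) = F(x) D with D the sum of the slopes; Gamma follows as F(y)/y. *)
Lemma ex_Cderive_Gamma (x : C) : ~ nonpos_int x -> exists l, is_Cderive Gamma x l.
Proof.
  intros Hx; assert (Hx0 := neq_0_of_not_nonpos_int x Hx).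
  destruct (pole_distance_nearby x Hx) as [k [Hk H]].
  set (d := Rmin 1 k).
  assert (Hd : (0 < d)%R) by (unfold d; apply Rmin_case; lra).
  assert (Hd1 : (d <= 1)%R) by apply Rmin_l.
  assert (Hd2 : (d <= k)%R) by apply Rmin_r.
  assert (Hp : forall h, (Cmod h <= d)%R -> ~ nonpos_int (x + h))
    by (intros h Hh; apply H; lra).
  assert (HhS : forall h n, (Cmod h <= d)%R ->
            (k * INR (S n) <= Cmod (x + h + RtoC (INR (S n))))%R).
  { intros h n Hh; eapply Rle_trans; [|apply H; lra]; rewrite (S_INR (S n)).
    assert (P := INR_S_pos n); nra. }
  assert (H0S : forall n, (k * INR (S n) <= Cmod (x + RtoC (INR (S n))))%R).
  { intro n; rewrite <- (Cplus_0_r x); apply HhS; rewrite Cmod_0; lra. }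
  (* The constants of [euler_ratio_bound] with H = 1, as |h| <= d <= 1, and of
     [euler_slope_bound]. *)
  set (A := (2 * (16 * exp (2 * 1) * (1 + 1 / k) + 2 / k + / (k * k)))%R).
  set (B := (2 * (2 + Cmod x / k))%R).
  destruct (ex_Clim_of_increments (csum (euler_slope x)) B) as [D HD].
  { intro n; simpl csum.
    replace (csum (euler_slope x) n + euler_slope x n - csum (euler_slope x) n)
      with (euler_slope x n) by ring.
    apply euler_slope_bound; [lra | apply H0S]. }
  set (F := fun y => y * Gamma y).
  assert (HF : is_Cderive F x (F x * D)).
  { exists d, (Cmod (F x) * ((A + B) + exp (A + B) * (A + B) * (A + B)))%R.
    split; [exact Hd|]; intros h Hh.
    destruct (ex_Clim_cprod_euler x h k) as [Q HQ]; [lra | exact H0S | |].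
    { intro n; now apply HhS. }
    assert (E : F (x + h) = F x * Q).
    { eapply Clim_unique; [now apply Gamma_Clim, Hp|].
      eapply (Clim_ext_loc _ _ _ O); [|apply (Clim_mult _ _ _ _ (Gamma_Clim x Hx) HQ)].
      intros n _; symmetry; apply cprod_mult; intro m; now apply euler_ratio_comp. }
    rewrite E.
    replace (F x * Q - F x - h * (F x * D)) with (F x * (Q - RtoC 1 - h * D)) by ring.
    rewrite Cmod_mult, Rmult_assoc; apply Rmult_le_compat_l; [apply Cmod_ge_0|].
    rewrite Rmult_comm.
    assert (T2 : forall n, (Cmod (euler_ratio x h n - RtoC 1 - h * euler_slope x n)
                 <= Cmod h * Cmod h * A * tele n)%R).
    { intro n; apply (euler_ratio_bound x h k 1); auto; lra. }
    assert (T1 : forall n, (Cmod (h * euler_slope x n) <= Cmod h * B * tele n)%R).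
    { intro n; rewrite Cmod_mult, Rmult_assoc.
      apply Rmult_le_compat_l; [apply Cmod_ge_0|].
      apply euler_slope_bound; [lra | apply H0S]. }
    assert (Ph := Cmod_ge_0 h).
    assert (PA : (0 <= A)%R).
    { unfold A; assert (X := exp_pos (2 * 1)).
      assert (0 < / k)%R by (apply Rinv_0_lt_compat; lra).
      assert (0 < / (k * k))%R by (apply Rinv_0_lt_compat; nra).
      unfold Rdiv; nra. }
    assert (PB : (0 <= B)%R).
    { unfold B; assert (0 <= Cmod x / k)%R
        by (apply Rdiv_le_0_compat; [apply Cmod_ge_0 | lra]). lra. }
    assert (L : Clim (fun n => cprod (euler_ratio x h) n + (- RtoC 1 + - h * csum (euler_slope x) n))
                  (Q + (- RtoC 1 + - h * D))).
    { apply Clim_plus; [exact HQ|]; apply Clim_plus; [apply Clim_const|].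
      now apply Clim_scal. }
    replace (Q - RtoC 1 - h * D) with (Q + (- RtoC 1 + - h * D)) by ring.
    refine (Clim_Cmod_le _ _ _ _ L); intro n.
    replace (cprod (euler_ratio x h) n + (- RtoC 1 + - h * csum (euler_slope x) n))
      with (cprod (euler_ratio x h) n - RtoC 1 - csum (fun m => h * euler_slope x m) n)
      by (rewrite csum_scal; ring).
    apply cprod_expansion; [lra | |].
    - intro m; replace (euler_ratio x h m - RtoC 1)
        with ((euler_ratio x h m - RtoC 1 - h * euler_slope x m) + h * euler_slope x m) by ring.
      eapply Rle_trans; [apply Cmod_triangle|].
      specialize (T1 m); specialize (T2 m); assert (Tp := tele_pos m).
      assert (Cmod h * Cmod h * A * tele m <= Cmod h * A * tele m)%R.
      { apply Rmult_le_compat_r; [lra|]; apply Rmult_le_compat_r; [lra|]. nra. }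
      lra.
    - intro m; eapply Rle_trans; [apply T2|].
      apply Rmult_le_compat_r; [left; apply tele_pos|].
      apply Rmult_le_compat_l; [nra | lra]. }
  exists (F x * D * / x + F x * - / (x * x)).
  apply (is_Cderive_ext_loc (fun y => F y * / y) _ _ _ d Hd).
  - intros h Hh; unfold F; field.
    now apply neq_0_of_not_nonpos_int, Hp.
  - apply is_Cderive_mult; [exact HF | now apply is_Cderive_inv].
Qed.

Lemma digamma_S (x : C) :
  ~ nonpos_int x -> digamma (x + RtoC 1) = digamma x + / x.
Proof.
  intros Hx; assert (Hx0 := neq_0_of_not_nonpos_int x Hx).
  assert (Hx1 : ~ nonpos_int (x + RtoC 1)).
  { rewrite <- INR_1; now apply nonpos_int_shift. }
  destruct (ex_Cderive_Gamma x Hx) as [l Hl].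
  destruct (ex_Cderive_Gamma _ Hx1) as [l1 Hl1].
  destruct (pole_distance_nearby x Hx) as [d [Hd Hn]].
  (* Both sides are the derivative of Gamma(y+1) = y Gamma(y) at y = x, by the shift and by the
     product rule. *)
  assert (E : l1 = RtoC 1 * Gamma x + x * l).
  { rewrite <- (is_Cderive_C_derive _ _ _ (is_Cderive_comp_shift _ _ _ _ Hl1)).
    apply is_Cderive_C_derive.
    apply (is_Cderive_ext_loc (fun y => y * Gamma y) _ _ _ d Hd).
    - intros h Hh; symmetry; now apply Gamma_S, Hn.
    - apply is_Cderive_mult; [apply is_Cderive_id | exact Hl]. }
  unfold digamma.
  rewrite (is_Cderive_C_derive _ _ _ Hl), (is_Cderive_C_derive _ _ _ Hl1), Gamma_S, E by exact Hx.
  assert (G := Gamma_neq_0 x Hx); field; auto.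
Qed.

Fixpoint harmonic (x : C) (k : nat) : C :=
  match k with O => RtoC 0 | S j => harmonic x j + / (x + RtoC (INR j)) end.

Lemma digamma_add_INR (x : C) (k : nat) :
  ~ nonpos_int x -> digamma (x + RtoC (INR k)) = digamma x + harmonic x k.
Proof.
  intros Hx; induction k as [|k IH].
  - simpl; now rewrite !Cplus_0_r.
  - rewrite S_INR, RtoC_plus, Cplus_assoc, digamma_S by (now apply nonpos_int_shift).
    rewrite IH; simpl; ring.
Qed.

Lemma pochhammer_rising (x : C) (k : nat) :
  ~ nonpos_int x -> pochhammer x k = rising x k.
Proof.
  intros Hx; unfold pochhammer; assert (G := Gamma_neq_0 x Hx).
  induction k as [|k IH].
  - simpl; rewrite Cplus_0_r; field; exact G.
  - rewrite S_INR, RtoC_plus, Cplus_assoc, Gamma_S by (now apply nonpos_int_shift).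
    simpl; rewrite <- IH; field; exact G.
Qed.

(** * Coefficients of Euler's transformation *)

Lemma csum_ext (f g : nat -> C) (n : nat) :
  (forall k, (k < n)%nat -> f k = g k) -> csum f n = csum g n.
Proof.
  induction n as [|n IH]; intros H; simpl; [reflexivity|].
  rewrite IH, H by (intros; try apply H; lia); reflexivity.
Qed.

Lemma csum_plus (f g : nat -> C) (n : nat) :
  csum (fun k => f k + g k) n = csum f n + csum g n.
Proof. induction n as [|n IH]; simpl; [ring | rewrite IH; ring]. Qed.

Lemma csum_S_l (f : nat -> C) (n : nat) :
  csum f (S n) = f O + csum (fun k => f (S k)) n.
Proof.
  induction n as [|n IH]; [simpl; ring|].
  change (csum f (S (S n))) with (csum f (S n) + f (S n)); rewrite IH; simpl; ring.
Qed.

Definition conv (w u : nat -> C) (n : nat) : C :=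
  csum (fun k => w (n - k)%nat * u k) (S n).

Definition hyp_term (a b c : C) (k : nat) : C :=
  rising a k * rising b k / (rising c k * RtoC (INR (fact k))).

(* The derivative of [hyp_term (a + e) (b + e) (c + 2 e) k] at [e = 0]. *)
Definition hyp_term_deriv (a b c : C) (k : nat) : C :=
  hyp_term a b c k * (harmonic a k + harmonic b k - RtoC 2 * harmonic c k).

(** The Taylor coefficients of (1-z)^(-a); a = b1 + b2 - c gives the prefactor of the theorem. *)
Definition binom_term (a : C) (k : nat) : C := rising a k / RtoC (INR (fact k)).

Lemma binom_term_S (a : C) (k : nat) :
  RtoC (INR (S k)) * binom_term a (S k) = (a + RtoC (INR k)) * binom_term a k.
Proof.
  unfold binom_term; change (fact (S k)) with (S k * fact k)%nat.
  rewrite mult_INR, RtoC_mult; simpl rising.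
  assert (A := INR_S_neq_0 k); assert (B := INR_fact_neq_0 k); field; auto.
Qed.

Lemma hyp_term_S (a b c : C) (k : nat) :
  ~ nonpos_int c ->
  RtoC (INR (S k)) * (c + RtoC (INR k)) * hyp_term a b c (S k)
  = (a + RtoC (INR k)) * (b + RtoC (INR k)) * hyp_term a b c k.
Proof.
  intros Hc; unfold hyp_term; change (fact (S k)) with (S k * fact k)%nat.
  rewrite mult_INR, RtoC_mult; simpl rising.
  assert (A := INR_S_neq_0 k); assert (B := INR_fact_neq_0 k).
  assert (D := rising_neq_0 c k Hc); assert (E := add_INR_neq_0 c k Hc).
  field; auto.
Qed.

(** The e-derivative of [hyp_term_S] along (a+e, b+e, c+2e); the 2 in front of [INR (S k)] is the
    speed of c. *)
Lemma hyp_term_deriv_S (a b c : C) (k : nat) :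
  ~ nonpos_int a -> ~ nonpos_int b -> ~ nonpos_int c ->
  RtoC (INR (S k)) * (c + RtoC (INR k)) * hyp_term_deriv a b c (S k)
    + RtoC 2 * RtoC (INR (S k)) * hyp_term a b c (S k)
  = (a + RtoC (INR k)) * (b + RtoC (INR k)) * hyp_term_deriv a b c k
    + (a + b + RtoC 2 * RtoC (INR k)) * hyp_term a b c k.
Proof.
  intros Ha Hb Hc; unfold hyp_term_deriv.
  assert (R := hyp_term_S a b c k Hc).
  assert (A := add_INR_neq_0 a k Ha); assert (B := add_INR_neq_0 b k Hb).
  assert (D := add_INR_neq_0 c k Hc).
  simpl harmonic.
  (* The extra summand on the left cancels exactly the -2/(c+k) contained in the logarithmic
     derivative at k+1. *)
  transitivity (RtoC (INR (S k)) * (c + RtoC (INR k)) * hyp_term a b c (S k)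
    * (harmonic a k + harmonic b k - RtoC 2 * harmonic c k
       + / (a + RtoC (INR k)) + / (b + RtoC (INR k)))).
  - field; auto.
  - rewrite R; field; auto.
Qed.

(** A weight n+1-k is absorbed by the binomial recurrence and lowers the binomial index; a weight k
    is moved to u by shifting the summation index. Each kills one end term, and both sums then run
    over the same [binom_term s (n - k)]. *)
Lemma conv_binom_split (s : C) (u p q : nat -> C) (n : nat) :
  csum (fun k => (p k * RtoC (INR (S n - k)) + q k * RtoC (INR k))
                 * (binom_term s (S n - k) * u k)) (S (S n))
  = csum (fun k => binom_term s (n - k)
                   * (p k * (s + RtoC (INR (n - k))) * u k
                      + q (S k) * (RtoC (INR (S k)) * u (S k)))) (S n).
Proof.
  rewrite (csum_ext _ (fun k => p k * (RtoC (INR (S n - k)) * binom_term s (S n - k)) * u k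
                                + q k * RtoC (INR k) * (binom_term s (S n - k) * u k)))
    by (intros; ring).
  rewrite csum_plus.
  rewrite (csum_S_l (fun k => q k * RtoC (INR k) * _)).
  change (csum ?f (S (S n))) with (csum f (S n) + f (S n)); cbv beta.
  rewrite Nat.sub_diag; change (INR 0) with 0%R.
  rewrite ?Cmult_0_l, ?Cmult_0_r, ?Cmult_0_l, Cplus_0_r, Cplus_0_l.
  rewrite <- csum_plus; apply csum_ext; intros k Hk.
  replace (S n - k)%nat with (S (n - k)) by lia.
  rewrite binom_term_S; change (S n - S k)%nat with (n - k)%nat; ring.
Qed.

(** Rests on the split (n+1)(c+n) = (c+n+k)(n+1-k) + (c+k-1)k. Its second part is chosen so that the
    index shift turns it into (k+1)(c+k), the factor that the recurrence of [hyp_term] rewrites. *)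
Lemma conv_binom_S (s c : C) (u : nat -> C) (n : nat) :
  RtoC (INR (S n)) * (c + RtoC (INR n)) * conv (binom_term s) u (S n)
  = csum (fun k => binom_term s (n - k)
                   * ((c + RtoC (INR n) + RtoC (INR k)) * (s + RtoC (INR (n - k))) * u k
                      + RtoC (INR (S k)) * (c + RtoC (INR k)) * u (S k))) (S n).
Proof.
  unfold conv; rewrite <- csum_scal.
  transitivity (csum (fun k => ((c + RtoC (INR n) + RtoC (INR k)) * RtoC (INR (S n - k))
        + (c + RtoC (INR k) - RtoC 1) * RtoC (INR k)) * (binom_term s (S n - k) * u k)) (S (S n))).
  - apply csum_ext; intros k Hk; f_equal.
    rewrite minus_INR, S_INR, !RtoC_minus, !RtoC_plus by lia; ring.
  - rewrite (conv_binom_split s u (fun k => c + RtoC (INR n) + RtoC (INR k))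
               (fun k => c + RtoC (INR k) - RtoC 1)).
    apply csum_ext; intros k Hk; rewrite S_INR, RtoC_plus; ring.
Qed.

(** The simpler split n+1 = (n+1-k) + k, needed for the inhomogeneous term of the differentiated
    recurrence. *)
Lemma conv_binom_S_degree (s : C) (u : nat -> C) (n : nat) :
  RtoC (INR (S n)) * conv (binom_term s) u (S n)
  = csum (fun k => binom_term s (n - k)
                   * ((s + RtoC (INR (n - k))) * u k + RtoC (INR (S k)) * u (S k))) (S n).
Proof.
  unfold conv; rewrite <- csum_scal.
  transitivity (csum (fun k => (RtoC 1 * RtoC (INR (S n - k)) + RtoC 1 * RtoC (INR k))
      * (binom_term s (S n - k) * u k)) (S (S n))).
  - apply csum_ext; intros k Hk; f_equal.
    rewrite minus_INR, RtoC_minus by lia; ring.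
  - rewrite (conv_binom_split s u (fun _ => RtoC 1) (fun _ => RtoC 1)).
    apply csum_ext; intros k Hk; ring.
Qed.

(** After the recurrence for u, the coefficient of [binom_term s (n - k) * u k] is (c+n+k)(s+n-k) +
    (c-b1+k)(c-b2+k). For s = b1 + b2 - c this equals (b1+n)(b2+n) whatever k is, so it leaves the
    sum. *)
Lemma conv_hyp_term_S (b1 b2 c : C) (n : nat) :
  ~ nonpos_int c ->
  let s := b1 + b2 - c in
  let u := hyp_term (c - b1) (c - b2) c in
  RtoC (INR (S n)) * (c + RtoC (INR n)) * conv (binom_term s) u (S n)
  = (b1 + RtoC (INR n)) * (b2 + RtoC (INR n)) * conv (binom_term s) u n.
Proof.
  intros hc s u; rewrite conv_binom_S; unfold conv; rewrite <- csum_scal.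
  apply csum_ext; intros k Hk; unfold u; rewrite hyp_term_S by exact hc.
  rewrite minus_INR, RtoC_minus by lia; unfold s; ring.
Qed.

(** The same collapse differentiated in e, with s fixed: the new coefficient 2(s+n-k) + (c-b1) +
    (c-b2) + 2k is b1 + b2 + 2n, again free of k. *)
Lemma conv_hyp_term_deriv_S (b1 b2 c : C) (n : nat) :
  ~ nonpos_int c -> ~ nonpos_int (c - b1) -> ~ nonpos_int (c - b2) ->
  let s := b1 + b2 - c in
  let u := hyp_term (c - b1) (c - b2) c in
  let u' := hyp_term_deriv (c - b1) (c - b2) c in
  RtoC (INR (S n)) * (c + RtoC (INR n)) * conv (binom_term s) u' (S n)
    + RtoC 2 * RtoC (INR (S n)) * conv (binom_term s) u (S n)
  = (b1 + RtoC (INR n)) * (b2 + RtoC (INR n)) * conv (binom_term s) u' n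
    + (b1 + b2 + RtoC 2 * RtoC (INR n)) * conv (binom_term s) u n.
Proof.
  intros hc hcb1 hcb2 s u u'.
  rewrite <- (Cmult_assoc (RtoC 2)), conv_binom_S_degree, conv_binom_S.
  unfold conv; rewrite <- !csum_scal, <- !csum_plus.
  apply csum_ext; intros k Hk.
  assert (R := hyp_term_deriv_S _ _ _ k hcb1 hcb2 hc); fold u u' in R.
  transitivity (binom_term s (n - k) *
    ((c + RtoC (INR n) + RtoC (INR k)) * (s + RtoC (INR (n - k))) * u' k
     + RtoC 2 * (s + RtoC (INR (n - k))) * u k
     + (RtoC (INR (S k)) * (c + RtoC (INR k)) * u' (S k) + RtoC 2 * RtoC (INR (S k)) * u (S k)))).
  - ring.
  - rewrite R, minus_INR, RtoC_minus by lia; unfold s; ring.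
Qed.

Lemma hyp_coef_cancel (c : C) (n : nat) (x y : C) :
  ~ nonpos_int c ->
  RtoC (INR (S n)) * (c + RtoC (INR n)) * x = RtoC (INR (S n)) * (c + RtoC (INR n)) * y ->
  x = y.
Proof.
  intros hc H.
  assert (A := INR_S_neq_0 n); assert (B := add_INR_neq_0 c n hc).
  replace x with (RtoC (INR (S n)) * (c + RtoC (INR n)) * x
                  / (RtoC (INR (S n)) * (c + RtoC (INR n)))) by (field; auto).
  rewrite H; field; auto.
Qed.

Lemma conv_hyp_term (b1 b2 c : C) (n : nat) :
  ~ nonpos_int c ->
  conv (binom_term (b1 + b2 - c)) (hyp_term (c - b1) (c - b2) c) n = hyp_term b1 b2 c n.
Proof.
  intros hc.
  induction n as [|n IH].
  - unfold conv, hyp_term, binom_term; simpl; field; repeat split; intro E; apply RtoC_inj in E; lra.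
  - apply (hyp_coef_cancel c n _ _ hc); rewrite conv_hyp_term_S, IH, hyp_term_S; auto.
Qed.

(** By [conv_hyp_term] the inhomogeneous terms of the two recurrences coincide, and both sequences
    start at 0. *)
Lemma conv_hyp_term_deriv (b1 b2 c : C) (n : nat) :
  ~ nonpos_int c -> ~ nonpos_int b1 -> ~ nonpos_int b2 ->
  ~ nonpos_int (c - b1) -> ~ nonpos_int (c - b2) ->
  conv (binom_term (b1 + b2 - c)) (hyp_term_deriv (c - b1) (c - b2) c) n
  = hyp_term_deriv b1 b2 c n.
Proof.
  intros hc hb1 hb2 hcb1 hcb2.
  induction n as [|n IH].
  - unfold conv, hyp_term_deriv; simpl; ring.
  - apply (hyp_coef_cancel c n _ _ hc).
    assert (R1 := conv_hyp_term_deriv_S b1 b2 c n hc hcb1 hcb2).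
    assert (R2 := hyp_term_deriv_S b1 b2 c n hb1 hb2 hc).
    cbv zeta in R1; rewrite IH, !conv_hyp_term, <- R2 in R1 by exact hc.
    set (h := RtoC 2 * RtoC (INR (S n)) * hyp_term b1 b2 c (S n)) in R1.
    match goal with |- ?x = ?y => replace x with (x + h - h) by ring end.
    rewrite R1; ring.
Qed.

(** * Power series with coefficients of polynomial growth *)

(** A class closed under sums, products and index shift that contains Pochhammer quotients and
    harmonic sums, and still forces absolute convergence on the open unit disc. *)
Definition poly_growth (a : nat -> C) : Prop :=
  exists (K : R) (M : nat), (0 <= K)%R /\
    forall k, (Cmod (a k) <= K * INR (S k) ^ M)%R.

Lemma pow_INR_S_le (k m n : nat) : (m <= n)%nat -> (INR (S k) ^ m <= INR (S k) ^ n)%R.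
Proof. intros H; apply Rle_pow; [apply INR_S_ge_1 | exact H]. Qed.

Lemma poly_growth_ext (a b : nat -> C) :
  (forall k, a k = b k) -> poly_growth a -> poly_growth b.
Proof.
  intros E (K & M & HK & H); exists K, M; split; [exact HK|].
  intro k; rewrite <- E; apply H.
Qed.

Lemma poly_growth_const (x : C) : poly_growth (fun _ => x).
Proof.
  exists (Cmod x), O; split; [apply Cmod_ge_0|]; intro k; simpl; lra.
Qed.

Lemma poly_growth_plus (a b : nat -> C) :
  poly_growth a -> poly_growth b -> poly_growth (fun k => a k + b k).
Proof.
  intros (K & M & HK & H) (K' & M' & HK' & H').
  exists (K + K')%R, (M + M')%nat; split; [lra|]; intro k.
  eapply Rle_trans; [apply Cmod_triangle|].
  rewrite Rmult_plus_distr_r; apply Rplus_le_compat.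
  - eapply Rle_trans; [apply H|]; apply Rmult_le_compat_l, pow_INR_S_le; [exact HK | lia].
  - eapply Rle_trans; [apply H'|]; apply Rmult_le_compat_l, pow_INR_S_le; [exact HK' | lia].
Qed.

Lemma poly_growth_mult (a b : nat -> C) :
  poly_growth a -> poly_growth b -> poly_growth (fun k => a k * b k).
Proof.
  intros (K & M & HK & H) (K' & M' & HK' & H').
  exists (K * K')%R, (M + M')%nat; split; [nra|]; intro k.
  rewrite Cmod_mult, pow_add.
  replace (K * K' * (INR (S k) ^ M * INR (S k) ^ M'))%R
    with (K * INR (S k) ^ M * (K' * INR (S k) ^ M'))%R by ring.
  apply Rmult_le_compat; auto using Cmod_ge_0.
Qed.

(* [1 + M / (k + 1) <= ((k + 2) / (k + 1)) ^ M], and these products telescope. *)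
Lemma poly_growth_ratio (a : nat -> C) (K : R) :
  (forall k, Cmod (a (S k)) <= (1 + K * / INR (S k)) * Cmod (a k))%R -> poly_growth a.
Proof.
  intros H; destruct (INR_unbounded K) as [M HM].
  exists (Cmod (a O)), M; split; [apply Cmod_ge_0|]; intro k.
  induction k as [|k IH].
  - rewrite INR_1, pow1; lra.
  - eapply Rle_trans; [apply H|].
    assert (P := inv_INR_S_pos k).
    assert (B := poly M (/ INR (S k)) P).
    eapply Rle_trans.
    { apply Rmult_le_compat_r with (r2 := ((1 + / INR (S k)) ^ M)%R); [apply Cmod_ge_0|].
      assert (K * / INR (S k) <= INR M * / INR (S k))%R
        by (apply Rmult_le_compat_r; lra). lra. }
    eapply Rle_trans; [apply Rmult_le_compat_l; [apply pow_le; lra | exact IH]|].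
    right; rewrite (S_INR (S k)).
    replace (INR (S k) + 1)%R with ((1 + / INR (S k)) * INR (S k))%R
      by (field; apply not_0_INR; lia).
    rewrite Rpow_mult_distr; ring.
Qed.

Lemma poly_growth_binom_term (x : C) : poly_growth (binom_term x).
Proof.
  apply poly_growth_ratio with (Cmod x); intro k.
  assert (P := INR_S_pos k).
  apply Rmult_le_reg_l with (INR (S k)); [exact P|].
  rewrite <- (Cmod_INR (S k)) at 1; rewrite <- Cmod_mult, binom_term_S, Cmod_mult.
  rewrite <- Rmult_assoc; apply Rmult_le_compat_r; [apply Cmod_ge_0|].
  eapply Rle_trans; [apply Cmod_triangle|]; rewrite Cmod_INR.
  rewrite Rmult_plus_distr_l, Rmult_1_r, (Rmult_comm (Cmod x)), <- Rmult_assoc, Rinv_r, S_INR by lra.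
  lra.
Qed.

Lemma poly_growth_inv_binom_term (x : C) :
  ~ nonpos_int x -> poly_growth (fun k => / binom_term x k).
Proof.
  intros Hx; destruct (pole_distance x Hx) as [d [Hd H]].
  (* The ratio of consecutive terms is (k+1)/(x+k) = 1 + (1-x)/(x+k), with |x+k| >= d (k+1). *)
  apply poly_growth_ratio with (Cmod (RtoC 1 - x) / d)%R; intro k.
  assert (P := INR_S_pos k); assert (N := INR_S_neq_0 k).
  assert (F := INR_fact_neq_0 k); assert (F' := INR_fact_neq_0 (S k)).
  assert (R := rising_neq_0 x k Hx); assert (R' := rising_neq_0 x (S k) Hx).
  assert (X := add_INR_neq_0 x k Hx).
  assert (E : / binom_term x (S k) = RtoC (INR (S k)) / (x + RtoC (INR k)) * / binom_term x k).
  { unfold binom_term in *; change (fact (S k)) with (S k * fact k)%nat.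
    rewrite mult_INR, RtoC_mult; simpl rising; field; auto. }
  rewrite E, Cmod_mult; apply Rmult_le_compat_r; [apply Cmod_ge_0|].
  replace (RtoC (INR (S k)) / (x + RtoC (INR k)))
    with (RtoC 1 + (RtoC 1 - x) / (x + RtoC (INR k)))
    by (rewrite S_INR, RtoC_plus; field; exact X).
  eapply Rle_trans; [apply Cmod_triangle|].
  rewrite Cmod_1, Cmod_div by exact X; apply Rplus_le_compat_l.
  unfold Rdiv; rewrite Rmult_assoc, <- Rinv_mult.
  apply Rmult_le_compat_l; [apply Cmod_ge_0|].
  apply Rinv_le_contravar; [nra | apply H].
Qed.

Lemma poly_growth_harmonic (x : C) : ~ nonpos_int x -> poly_growth (harmonic x).
Proof.
  intros Hx; destruct (pole_distance x Hx) as [d [Hd H]].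
  assert (Pd : (0 < / d)%R) by now apply Rinv_0_lt_compat.
  exists (/ d)%R, 1%nat; split; [lra|]; intro k; rewrite pow_1.
  induction k as [|k IH].
  - simpl harmonic; rewrite Cmod_0, INR_1; lra.
  - simpl harmonic; eapply Rle_trans; [apply Cmod_triangle|].
    rewrite (S_INR (S k)), Rmult_plus_distr_l, Rmult_1_r.
    apply Rplus_le_compat; [exact IH|].
    rewrite Cmod_inv by (now apply add_INR_neq_0).
    apply Rinv_le_contravar; [exact Hd|].
    specialize (H k); assert (W := INR_S_ge_1 k); nra.
Qed.

Lemma poly_growth_hyp_term (a b c : C) : ~ nonpos_int c -> poly_growth (hyp_term a b c).
Proof.
  intros Hc.
  apply (poly_growth_ext (fun k => binom_term a k * binom_term b k * / binom_term c k)).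
  - intro k; unfold binom_term, hyp_term.
    assert (F := INR_fact_neq_0 k); assert (R := rising_neq_0 c k Hc); field; auto.
  - apply (poly_growth_mult (fun k => binom_term a k * binom_term b k)).
    + apply poly_growth_mult; apply poly_growth_binom_term.
    + now apply poly_growth_inv_binom_term.
Qed.

Lemma poly_growth_hyp_term_deriv (a b c : C) :
  ~ nonpos_int a -> ~ nonpos_int b -> ~ nonpos_int c -> poly_growth (hyp_term_deriv a b c).
Proof.
  intros Ha Hb Hc; apply poly_growth_mult; [now apply poly_growth_hyp_term|].
  apply (poly_growth_ext (fun k => harmonic a k + harmonic b k + (- RtoC 2) * harmonic c k)).
  - intro k; ring.
  - apply poly_growth_plus; [apply poly_growth_plus; now apply poly_growth_harmonic|].
    apply (poly_growth_mult (fun _ => - RtoC 2));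
      [apply poly_growth_const | now apply poly_growth_harmonic].
Qed.

Lemma ex_series_pow_geom (M : nat) (r : R) :
  (0 <= r < 1)%R -> ex_series (fun k => INR (S k) ^ M * r ^ k)%R.
Proof.
  (* D'Alembert's test divides by the terms, which vanish when r = 0; the larger ratio q is positive
     and still below 1. *)
  intros Hr; set (q := Rmax r (/ 2)).
  assert (Hq : (0 < q < 1)%R).
  { unfold q; split; [eapply Rlt_le_trans; [|apply Rmax_r]; lra | apply Rmax_case; lra]. }
  assert (Hrq : (r <= q)%R) by apply Rmax_l.
  assert (Pos : forall k, (0 < INR (S k) ^ M * q ^ k)%R).
  { intro k; apply Rmult_lt_0_compat; apply pow_lt; [apply INR_S_pos | lra]. }
  apply (ex_series_le (K := R_AbsRing) (V := R_CompleteNormedModule) _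
           (fun k => Rabs (INR (S k) ^ M * q ^ k))%R).
  - intro k; change (norm ?x) with (Rabs x); rewrite !Rabs_mult.
    apply Rmult_le_compat_l; [apply Rabs_pos|].
    rewrite !Rabs_pos_eq by (apply pow_le; lra).
    apply pow_incr; lra.
  - apply ex_series_DAlembert with q; [lra | |].
    + intro k; specialize (Pos k); lra.
    + assert (L : is_lim_seq (fun k => (1 + / INR (S k)) ^ M)%R 1%R).
      { clear; induction M as [|M IH]; [apply is_lim_seq_const|].
        simpl; rewrite <- (Rmult_1_r 1) at 1; apply is_lim_seq_mult'; [|exact IH].
        rewrite <- (Rplus_0_r 1) at 1; apply is_lim_seq_plus'; [apply is_lim_seq_const|].
        apply (is_lim_seq_incr_1 (fun n => / INR n)%R 0%R).
        apply (is_lim_seq_inv _ p_infty); [apply is_lim_seq_INR | easy]. }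
      assert (L' := is_lim_seq_mult' _ _ _ _ L (is_lim_seq_const q)).
      rewrite Rmult_1_l in L'; eapply is_lim_seq_ext; [|exact L'].
      intro k; cbv beta.
      assert (P := Pos k); assert (P' := Pos (S k)); assert (PS := INR_S_pos k).
      rewrite Rabs_pos_eq by (apply Rdiv_le_0_compat; [left; exact P' | exact P]).
      replace (INR (S (S k))) with ((1 + / INR (S k)) * INR (S k))%R
        by (rewrite (S_INR (S k)); field; lra).
      rewrite Rpow_mult_distr, <- (tech_pow_Rmult q k); field; split; apply pow_nonzero; lra.
Qed.

(** * Complex series and Cauchy products *)

Definition is_Cseries (a : nat -> C) (l : C) : Prop :=
  is_series (fun n => Re (a n)) (Re l) /\ is_series (fun n => Im (a n)) (Im l).

Lemma is_Cseries_unique (a : nat -> C) (l : C) : is_Cseries a l -> CSeries a = l.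
Proof. intros [H1 H2]; apply C_eq; simpl; now apply is_series_unique. Qed.

Lemma is_Cseries_ext (a b : nat -> C) (l : C) :
  (forall n, a n = b n) -> is_Cseries a l -> is_Cseries b l.
Proof.
  intros E [H1 H2]; split.
  - eapply is_series_ext; [|exact H1]; intro; simpl; now rewrite E.
  - eapply is_series_ext; [|exact H2]; intro; simpl; now rewrite E.
Qed.

Lemma is_Cseries_plus (a b : nat -> C) (la lb : C) :
  is_Cseries a la -> is_Cseries b lb -> is_Cseries (fun n => a n + b n) (la + lb).
Proof.
  intros [A1 A2] [B1 B2]; split.
  - exact (is_series_plus _ _ _ _ A1 B1).
  - exact (is_series_plus _ _ _ _ A2 B2).
Qed.

Lemma is_Cseries_scal (x : C) (a : nat -> C) (l : C) :
  is_Cseries a l -> is_Cseries (fun n => x * a n) (x * l).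
Proof.
  intros [A1 A2]; split.
  - exact (is_series_minus _ _ _ _ (is_series_scal (K := R_AbsRing) (Re x) _ _ A1)
             (is_series_scal (K := R_AbsRing) (Im x) _ _ A2)).
  - exact (is_series_plus _ _ _ _ (is_series_scal (K := R_AbsRing) (Re x) _ _ A2)
             (is_series_scal (K := R_AbsRing) (Im x) _ _ A1)).
Qed.

Lemma ex_series_Re_Im_abs (a : nat -> C) :
  ex_series (fun n => Cmod (a n)) ->
  ex_series (fun n => Rabs (Re (a n))) /\ ex_series (fun n => Rabs (Im (a n))).
Proof.
  intros H; split; eapply (ex_series_le (K := R_AbsRing) (V := R_CompleteNormedModule));
    try exact H; intro n; change (norm ?x) with (Rabs x); rewrite Rabs_Rabsolu.
  - apply re_le_Cmod.
  - apply im_le_Cmod.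
Qed.

Lemma ex_Cseries (a : nat -> C) :
  ex_series (fun n => Cmod (a n)) -> is_Cseries a (CSeries a).
Proof.
  intros H; destruct (ex_series_Re_Im_abs a H) as [H1 H2].
  split; apply Series_correct; now apply ex_series_Rabs.
Qed.

Lemma Re_csum (f : nat -> C) (n : nat) :
  Re (csum f (S n)) = sum_f_R0 (fun k => Re (f k)) n.
Proof.
  induction n as [|n IH]; [simpl; unfold Re, Im; ring|].
  change (csum f (S (S n))) with (csum f (S n) + f (S n)).
  rewrite tech5, <- IH; reflexivity.
Qed.

Lemma Im_csum (f : nat -> C) (n : nat) :
  Im (csum f (S n)) = sum_f_R0 (fun k => Im (f k)) n.
Proof.
  induction n as [|n IH]; [simpl; unfold Re, Im; ring|].
  change (csum f (S (S n))) with (csum f (S n) + f (S n)).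
  rewrite tech5, <- IH; reflexivity.
Qed.

Lemma is_Cseries_conv (a b : nat -> C) (la lb : C) :
  is_Cseries a la -> is_Cseries b lb ->
  ex_series (fun n => Cmod (a n)) -> ex_series (fun n => Cmod (b n)) ->
  is_Cseries (conv a b) (la * lb).
Proof.
  intros [A1 A2] [B1 B2] HA HB.
  destruct (ex_series_Re_Im_abs a HA) as [a1 a2].
  destruct (ex_series_Re_Im_abs b HB) as [b1 b2].
  (* [is_series_mult] puts the index n-k on its second factor, [conv] on its first; each component
     combines two real Cauchy products. *)
  rewrite Cmult_comm; split.
  - eapply is_series_ext; [|exact (is_series_minus _ _ _ _
      (is_series_mult _ _ _ _ B1 A1 b1 a1) (is_series_mult _ _ _ _ B2 A2 b2 a2))].
    intro n; unfold conv; rewrite Re_csum.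
    unfold plus, opp; simpl; change (?x + - ?y)%R with (x - y)%R.
    rewrite <- minus_sum; apply sum_eq; intros; simpl; unfold Re, Im; ring.
  - eapply is_series_ext; [|exact (is_series_plus _ _ _ _
      (is_series_mult _ _ _ _ B1 A2 b1 a2) (is_series_mult _ _ _ _ B2 A1 b2 a1))].
    intro n; unfold conv; rewrite Im_csum.
    unfold plus; simpl.
    rewrite <- plus_sum; apply sum_eq; intros; simpl; unfold Re, Im; ring.
Qed.

(** Convertible to the summand of [CPSeries], in a form on which [ring] works. *)
Definition pow_term (z : C) (a : nat -> C) (k : nat) : C := z ^ k * a k.

Lemma ex_series_pow_term (a : nat -> C) (z : C) :
  poly_growth a -> (Cmod z < 1)%R -> ex_series (fun k => Cmod (pow_term z a k)).
Proof.
  intros (K & M & HK & H) Hz.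
  apply (ex_series_le (K := R_AbsRing) (V := R_CompleteNormedModule) _
           (fun k => K * (INR (S k) ^ M * Cmod z ^ k))%R).
  - intro k; change (norm ?x) with (Rabs x).
    rewrite Rabs_pos_eq by apply Cmod_ge_0; unfold pow_term; rewrite Cmod_mult, Cmod_pow.
    rewrite Rmult_comm, <- Rmult_assoc.
    apply Rmult_le_compat_r; [apply pow_le, Cmod_ge_0 | apply H].
  - apply (ex_series_scal_l K (fun k => INR (S k) ^ M * Cmod z ^ k)%R), ex_series_pow_geom; split; [apply Cmod_ge_0 | exact Hz].
Qed.

Lemma ex_pseries_poly_growth (a : nat -> C) (z : C) :
  poly_growth a -> (Cmod z < 1)%R -> ex_pseries (V := C_NormedModule) a z.
Proof.
  intros Ha Hz.
  apply (ex_series_le (K := C_AbsRing) (V := C_CompleteNormedModule) _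
           (fun k => Cmod (pow_term z a k))).
  - intro k; apply Rle_refl.
  - now apply ex_series_pow_term.
Qed.

Lemma CPSeries_correct (a : nat -> C) (z : C) :
  poly_growth a -> (Cmod z < 1)%R -> is_Cseries (pow_term z a) (CPSeries a z).
Proof. intros Ha Hz; exact (ex_Cseries _ (ex_series_pow_term a z Ha Hz)). Qed.

Lemma CPSeries_unique (a : nat -> C) (z l : C) :
  is_Cseries (pow_term z a) l -> CPSeries a z = l.
Proof. apply is_Cseries_unique. Qed.

Lemma CPSeries_conv (a b : nat -> C) (z : C) :
  poly_growth a -> poly_growth b -> (Cmod z < 1)%R ->
  CPSeries (conv a b) z = CPSeries a z * CPSeries b z.
Proof.
  intros Ha Hb Hz; apply CPSeries_unique.
  eapply is_Cseries_ext; [|apply is_Cseries_conv;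
    try (apply CPSeries_correct; eassumption); apply ex_series_pow_term; assumption].
  intro n; unfold conv, pow_term; rewrite <- csum_scal; apply csum_ext; intros k Hk.
  replace (z ^ n) with (z ^ (n - k) * z ^ k) by (rewrite <- Cpow_add_r; f_equal; lia).
  ring.
Qed.

Lemma CPSeries_ext (a b : nat -> C) (z : C) :
  (forall k, a k = b k) -> CPSeries a z = CPSeries b z.
Proof.
  intros E; unfold CPSeries, CSeries; f_equal; apply Series_ext; intro k; now rewrite E.
Qed.

Lemma CPSeries_scal_plus (x : C) (a b : nat -> C) (z : C) :
  poly_growth a -> poly_growth b -> (Cmod z < 1)%R ->
  CPSeries (fun k => x * a k + b k) z = x * CPSeries a z + CPSeries b z.
Proof.
  intros Ha Hb Hz; apply CPSeries_unique.
  eapply is_Cseries_ext;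
    [|apply is_Cseries_plus; [apply is_Cseries_scal|]; apply CPSeries_correct; eassumption].
  intro k; unfold pow_term; ring.
Qed.

Lemma CPSeries_scal (x : C) (a : nat -> C) (z : C) :
  poly_growth a -> (Cmod z < 1)%R -> CPSeries (fun k => x * a k) z = x * CPSeries a z.
Proof.
  intros Ha Hz; apply CPSeries_unique.
  eapply is_Cseries_ext; [|apply is_Cseries_scal, CPSeries_correct; eassumption].
  intro k; unfold pow_term; ring.
Qed.

(** * The binomial series *)

Lemma poly_growth_S (a : nat -> C) : poly_growth a -> poly_growth (fun k => a (S k)).
Proof.
  intros (K & M & HK & H); exists (K * 2 ^ M)%R, M.
  assert (P2 : (0 < 2 ^ M)%R) by (apply pow_lt; lra).
  split; [nra|]; intro k; eapply Rle_trans; [apply H|].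
  rewrite Rmult_assoc, <- Rpow_mult_distr; apply Rmult_le_compat_l; [exact HK|].
  apply pow_incr; assert (W := INR_S_ge_1 k); rewrite (S_INR (S k)); lra.
Qed.

Lemma poly_growth_INR : poly_growth (fun k => RtoC (INR k)).
Proof.
  exists 1%R, 1%nat; split; [lra|]; intro k; rewrite Cmod_INR, pow_1, S_INR; lra.
Qed.

Lemma CPSeries_S (a : nat -> C) (z : C) :
  poly_growth a -> (Cmod z < 1)%R ->
  CPSeries a z = a O + z * CPSeries (fun k => a (S k)) z.
Proof.
  intros Ha Hz.
  assert (H := is_Cseries_scal z _ _ (CPSeries_correct _ z (poly_growth_S a Ha) Hz)).
  apply CPSeries_unique.
  apply (is_Cseries_ext _ (fun k => pow_term z a (S k))) in H.
  - destruct H as [H1 H2]; split; apply is_series_decr_1.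
    + evar_last; [exact H1 | unfold plus, opp; simpl; unfold Re, Im; ring].
    + evar_last; [exact H2 | unfold plus, opp; simpl; unfold Re, Im; ring].
  - intro k; unfold pow_term; simpl; ring.
Qed.

Lemma Re_mult_RtoC (x : C) (r : R) : Re (x * RtoC r) = (Re x * r)%R.
Proof. simpl; unfold Re; ring. Qed.

Lemma Im_mult_RtoC (x : C) (r : R) : Im (x * RtoC r) = (Im x * r)%R.
Proof. simpl; unfold Im; ring. Qed.

Lemma Cpow_scal (t : R) (z : C) (k : nat) : (RtoC t * z) ^ k = RtoC (t ^ k) * z ^ k.
Proof.
  induction k as [|k IH]; [simpl; ring|].
  change ((RtoC t * z) ^ S k) with (RtoC t * z * (RtoC t * z) ^ k).
  change (z ^ S k) with (z * z ^ k); rewrite IH, <- tech_pow_Rmult, RtoC_mult; ring.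
Qed.

(** The endpoint t = 1 is included, so the radius must exceed 1: r = 2/(1+|z|) satisfies r > 1 and
    r|z| < 1. The function [f] will be [Re] or [Im]. *)
Lemma lt_CV_radius_pow_term (a : nat -> C) (z : C) (f : C -> R) (t : R) :
  (forall x, Rabs (f x) <= Cmod x)%R ->
  poly_growth a -> (Cmod z < 1)%R -> (Rabs t <= 1)%R ->
  Rbar_lt (Rabs t) (CV_radius (fun k => f (pow_term z a k))).
Proof.
  intros Hf Ha Hz Ht; assert (P := Cmod_ge_0 z).
  set (r := (2 / (1 + Cmod z))%R).
  assert (E : (r * (1 + Cmod z) = 2)%R) by (unfold r; field; lra).
  assert (Hr : (1 < r)%R) by nra.
  apply (Rbar_lt_le_trans _ r); [simpl; lra|].
  apply (Lub_Rbar_correct (CV_disk _)).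
  apply (ex_series_le (K := R_AbsRing) (V := R_CompleteNormedModule) _
           (fun k => Cmod (pow_term (RtoC r * z) a k))).
  - intro k; change (norm ?x) with (Rabs x); rewrite Rabs_Rabsolu, Rabs_mult.
    unfold pow_term; rewrite Cpow_scal, <- Cmult_assoc, (Cmod_mult (RtoC _)), Cmod_R, Rmult_comm.
    apply Rmult_le_compat_l; [apply Rabs_pos | apply Hf].
  - apply ex_series_pow_term; [exact Ha|].
    rewrite Cmod_mult, Cmod_R, Rabs_pos_eq by lra; nra.
Qed.

(** Along the ray through z, each component is a real power series in u with coefficients [Re] or
    [Im] of z^k a_k, so real termwise differentiation applies. *)
Lemma is_Rderive_CPSeries (a : nat -> C) (z : C) (t : R) :
  poly_growth a -> (Cmod z < 1)%R -> (Rabs t <= 1)%R ->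
  is_Rderive (fun u => CPSeries a (RtoC u * z)) t
    (z * CPSeries (fun k => RtoC (INR (S k)) * a (S k)) (RtoC t * z)).
Proof.
  intros Ha Hz Ht.
  assert (Hb : poly_growth (fun k => RtoC (INR (S k)) * a (S k))).
  { apply (poly_growth_S (fun k => RtoC (INR k) * a k)).
    now apply poly_growth_mult; [apply poly_growth_INR|]. }
  assert (Htz : (Cmod (RtoC t * z) < 1)%R)
    by (eapply Rle_lt_trans; [now apply Cmod_scal_le | exact Hz]).
  destruct (is_Cseries_scal z _ _ (CPSeries_correct _ _ Hb Htz)) as [S1 S2].
  assert (D1 := is_derive_PSeries _ _ (lt_CV_radius_pow_term a z Re t re_le_Cmod Ha Hz Ht)).
  assert (D2 := is_derive_PSeries _ _ (lt_CV_radius_pow_term a z Im t im_le_Cmod Ha Hz Ht)).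
  assert (E : forall k, z * pow_term (RtoC t * z) (fun k => RtoC (INR (S k)) * a (S k)) k
               = RtoC (INR (S k)) * pow_term z a (S k) * RtoC (t ^ k)).
  { intro k; unfold pow_term; rewrite Cpow_scal.
    change (z ^ S k) with (z * z ^ k); ring. }
  assert (E' : forall u k, scal (pow_n (RtoC u * z) k : C) (a k) = pow_term z a k * RtoC (u ^ k)).
  { intros u k; change ((RtoC u * z) ^ k * a k = pow_term z a k * RtoC (u ^ k)).
    rewrite Cpow_scal; unfold pow_term; ring. }
  split.
  - evar_last.
    + eapply is_derive_ext; [|exact D1].
      intro u; apply Series_ext; intro k; symmetry.
      exact (eq_trans (f_equal Re (E' u k)) (Re_mult_RtoC _ _)).
    + rewrite <- (is_series_unique _ _ S1); apply Series_ext; intro k.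
      rewrite E, Re_mult_RtoC, Cmult_comm, Re_mult_RtoC; unfold PS_derive; f_equal.
      apply Rmult_comm.
  - evar_last.
    + eapply is_derive_ext; [|exact D2].
      intro u; apply Series_ext; intro k; symmetry.
      exact (eq_trans (f_equal Im (E' u k)) (Im_mult_RtoC _ _)).
    + rewrite <- (is_series_unique _ _ S2); apply Series_ext; intro k.
      rewrite E, Im_mult_RtoC, Cmult_comm, Im_mult_RtoC; unfold PS_derive; f_equal.
      apply Rmult_comm.
Qed.

(** Removes the case distinction of [Carg] at the real axis: in the right half-plane, which is open,
    the argument becomes a visibly differentiable expression. *)
Lemma Carg_atan (w : C) : (0 < Re w)%R -> Carg w = atan (Im w / Re w).
Proof.
  intros Hx; unfold Carg.
  assert (Hw : (0 < Cmod w)%R).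
  { eapply Rlt_le_trans; [exact Hx|].
    eapply Rle_trans; [apply Rle_abs | apply re_le_Cmod]. }
  assert (E : acos (Re w / Cmod w) = atan (Rabs (Im w) / Re w)).
  { rewrite acos_atan by (now apply Rdiv_lt_0_compat).
    f_equal.
    replace (1 - (Re w / Cmod w)²)%R with ((Rabs (Im w) / Cmod w)²)%R.
    - rewrite sqrt_Rsqr by (apply Rdiv_le_0_compat; [apply Rabs_pos | exact Hw]).
      field; lra.
    - assert (Q := Cmod2_alt w).
      rewrite !Rsqr_div', <- Rsqr_abs, !Rsqr_pow2.
      replace (Im w ^ 2)%R with (Cmod w ^ 2 - Re w ^ 2)%R by lra.
      field; lra. }
  rewrite E; destruct (Rle_dec 0 (Im w)) as [Hy | Hy].
  - now rewrite Rabs_pos_eq.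
  - rewrite Rabs_left, <- atan_opp by lra; f_equal; field; lra.
Qed.

Lemma is_Rderive_Clog (z : C) (t : R) :
  (0 < Re (RtoC 1 - RtoC t * z))%R ->
  is_Rderive (fun u => Clog (RtoC 1 - RtoC u * z)) t (- z / (RtoC 1 - RtoC t * z)).
Proof.
  destruct z as [x y]; intros H; simpl in H.
  set (X := (fun u : R => 1 - u * x)%R); set (Y := (fun u : R => - (u * y))%R).
  assert (HX : (0 < X t)%R) by (unfold X; lra).
  assert (EX : forall u, Re (RtoC 1 - RtoC u * (x, y)) = X u) by (intro; simpl; unfold X; ring).
  assert (EY : forall u, Im (RtoC 1 - RtoC u * (x, y)) = Y u) by (intro; simpl; unfold Y; ring).
  assert (Hpos : (0 < X t * X t + Y t * Y t)%R) by nra.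
  split; simpl.
  - apply (is_derive_ext (fun u => ln (sqrt (X u * X u + Y u * Y u)))).
    { intro u; unfold Cmod; f_equal; f_equal; simpl; unfold X, Y; ring. }
    unfold X, Y in *; auto_derive.
    + repeat split; auto; now apply sqrt_lt_R0.
    + set (q := sqrt _).
      assert (Q : (q * q = (1 - t * x) * (1 - t * x) + - (t * y) * - (t * y))%R)
        by (apply sqrt_sqrt; lra).
      assert (Q0 : (0 < q)%R) by (now apply sqrt_lt_R0).
      field_simplify_eq; [|split; lra].
      replace (q ^ 2)%R with (q * q)%R by ring; rewrite Q; ring.
  - apply (is_derive_ext_loc (fun u => atan (Y u / X u))).
    { assert (L : locally t (fun u => 0 < X u)%R).
      { apply (ex_derive_continuous X t).
        - unfold X; auto_derive; auto.
        - now apply (open_gt 0 (X t)). }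
      revert L; apply filter_imp; intros u Hu.
      rewrite Carg_atan; rewrite ?EX, ?EY; auto. }
    unfold X, Y in *; auto_derive; [lra|].
    simpl; field; repeat split; lra.
Qed.

(** The series f satisfies (1-y) f'(y) = a f(y), by the recurrence of its coefficients. Hence f(tz)
    (1-tz)^a has derivative 0 for t in [0,1], and its value at t = 0 is 1. *)
Lemma binomial_series (a z : C) :
  (Cmod z < 1)%R -> CPSeries (binom_term a) z = Cpower (RtoC 1 - z) (- a).
Proof.
  intros Hz.
  set (w := binom_term a); assert (Hw : poly_growth w) by apply poly_growth_binom_term.
  set (b := fun k => RtoC (INR (S k)) * w (S k)).
  assert (Hb : poly_growth b).
  { apply (poly_growth_S (fun k => RtoC (INR k) * w k)).
    now apply poly_growth_mult; [apply poly_growth_INR|]. }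
  assert (ODE : forall y, (Cmod y < 1)%R -> (RtoC 1 - y) * CPSeries b y = a * CPSeries w y).
  { intros y Hy.
    assert (E : CPSeries b y = a * CPSeries w y + y * CPSeries b y).
    { transitivity (CPSeries (fun k => a * w k + RtoC (INR k) * w k) y).
      - apply CPSeries_ext; intro k; unfold b, w; rewrite binom_term_S; ring.
      - rewrite CPSeries_scal_plus;
          [|exact Hw|now apply poly_growth_mult; [apply poly_growth_INR|]|exact Hy].
        rewrite (CPSeries_S (fun k => RtoC (INR k) * w k));
          [|now apply poly_growth_mult; [apply poly_growth_INR|]|exact Hy].
        simpl INR at 1; rewrite Cmult_0_l, Cplus_0_l; reflexivity. }
    replace ((RtoC 1 - y) * CPSeries b y) with (CPSeries b y - y * CPSeries b y) by ring.
    rewrite E at 1; ring. }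
  set (h := fun t : R => CPSeries w (RtoC t * z) * Cexp (a * Clog (RtoC 1 - RtoC t * z))).
  assert (Hder : forall t, (0 <= t <= 1)%R -> is_Rderive h t (RtoC 0)).
  { intros t Ht.
    assert (Ht' : (Rabs t <= 1)%R) by (rewrite Rabs_pos_eq; lra).
    assert (Htz : (Cmod (RtoC t * z) < 1)%R)
      by (eapply Rle_lt_trans; [now apply Cmod_scal_le | exact Hz]).
    assert (Hre : (0 < Re (RtoC 1 - RtoC t * z))%R).
    { change (Re (RtoC 1 - RtoC t * z)) with (1 - Re (RtoC t * z))%R.
      assert (Q := Rle_abs (Re (RtoC t * z))); assert (Q' := re_le_Cmod (RtoC t * z)); lra. }
    assert (Hne : RtoC 1 - RtoC t * z <> RtoC 0).
    { intro E; rewrite E in Hre; simpl in Hre; lra. }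
    replace (RtoC 0) with
      (z * CPSeries b (RtoC t * z) * Cexp (a * Clog (RtoC 1 - RtoC t * z))
       + CPSeries w (RtoC t * z) * ((RtoC 0 * Clog (RtoC 1 - RtoC t * z)
                 + a * (- z / (RtoC 1 - RtoC t * z))) * Cexp (a * Clog (RtoC 1 - RtoC t * z)))).
    - apply is_Rderive_mult; [now apply is_Rderive_CPSeries|].
      apply (is_Rderive_Cexp (fun u => a * Clog (RtoC 1 - RtoC u * z))).
      apply (is_Rderive_mult (fun _ => a)); [|now apply is_Rderive_Clog].
      split; apply (is_derive_const (K := R_AbsRing) (V := R_NormedModule)).
    - replace (CPSeries b (RtoC t * z))
        with (a * CPSeries w (RtoC t * z) / (RtoC 1 - RtoC t * z))
        by (rewrite <- ODE by exact Htz; field; exact Hne).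
      field; exact Hne. }
  assert (H01 : h 0%R = h 1%R).
  { apply C_eq; apply (eq_is_derive (V := R_NormedModule) (fun t => _ (h t)));
      try lra; intros t Ht; apply (Hder t Ht). }
  unfold h in H01.
  rewrite !Cmult_1_l, Cmult_0_l in H01.
  rewrite (CPSeries_S w (RtoC 0)), Cmult_0_l, Cplus_0_r in H01
    by (try exact Hw; rewrite Cmod_0; lra).
  assert (E0 : Clog (RtoC 1 - RtoC 0) = RtoC 0).
  { replace (RtoC 1 - RtoC 0) with (RtoC 1) by ring.
    unfold Clog; rewrite Carg_atan, Cmod_1, ln_1 by (simpl; lra).
    apply C_eq; simpl; [reflexivity|]. unfold Rdiv; rewrite Rmult_0_l; apply atan_0. }
  rewrite E0, Cmult_0_r, Cexp_0 in H01.
  assert (W0 : w O = RtoC 1).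
  { unfold w, binom_term; simpl; field; intro E; apply RtoC_inj in E; lra. }
  rewrite W0, Cmult_1_l in H01.
  unfold Cpower.
  replace (- a * Clog (RtoC 1 - z)) with (- (a * Clog (RtoC 1 - z))) by ring.
  transitivity (CPSeries w z * (Cexp (- (a * Clog (RtoC 1 - z))) * Cexp (a * Clog (RtoC 1 - z)))).
  - rewrite Cexp_opp_mult; ring.
  - rewrite (Cmult_comm (Cexp (- _))), Cmult_assoc, <- H01; ring.
Qed.

(** * The transformation with digamma coefficients *)

Theorem theorem2p2 (b1 b2 c : C)
  (hc : ~ nonpos_int c)
  (hb1 : ~ nonpos_int b1) (hb2 : ~ nonpos_int b2)
  (hcb1 : ~ nonpos_int (c - b1)) (hcb2 : ~ nonpos_int (c - b2))
  (z : C) (hz : (Cmod z < 1)%R) :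
  let A (k : nat) : C :=
    pochhammer (c - b1) k * pochhammer (c - b2) k
      / (pochhammer c k * RtoC (INR (fact k)))
    * (digamma (c - b1 + RtoC (INR k)) + digamma (c - b2 + RtoC (INR k))
       - RtoC 2 * digamma (c + RtoC (INR k))) in
  let B (k : nat) : C :=
    pochhammer b1 k * pochhammer b2 k
      / (pochhammer c k * RtoC (INR (fact k)))
    * (RtoC 2 * digamma (c + RtoC (INR k))
       - digamma (b1 + RtoC (INR k)) - digamma (b2 + RtoC (INR k))) in
  ex_pseries (V := C_NormedModule) A z /\
  ex_pseries (V := C_NormedModule) B z /\
  ex_pseries (V := C_NormedModule) (hyp2F1_coef b1 b2 c) z /\
  Cpower (RtoC 1 - z) (c - b1 - b2) * CPSeries A z + CPSeries B z
  = (digamma (c - b1) + digamma (c - b2) - digamma b1 - digamma b2)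
    * hyp2F1 b1 b2 c z.
Proof.
  intros A B.
  set (u := hyp_term (c - b1) (c - b2) c); set (v := hyp_term b1 b2 c).
  set (u' := hyp_term_deriv (c - b1) (c - b2) c); set (v' := hyp_term_deriv b1 b2 c).
  (* The values at k = 0 of the two digamma brackets; in their sum the terms in psi(c) cancel,
     leaving the constant on the right-hand side. *)
  set (psiA := digamma (c - b1) + digamma (c - b2) - RtoC 2 * digamma c).
  set (psiB := RtoC 2 * digamma c - digamma b1 - digamma b2).
  assert (gu : poly_growth u) by now apply poly_growth_hyp_term.
  assert (gv : poly_growth v) by now apply poly_growth_hyp_term.
  assert (gu' : poly_growth u') by now apply poly_growth_hyp_term_deriv.
  assert (gv' : poly_growth v') by now apply poly_growth_hyp_term_deriv.
  assert (EA : forall k, psiA * u k + u' k = A k).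
  { intro k; unfold A, psiA, u, u', hyp_term_deriv, hyp_term.
    rewrite !pochhammer_rising, !digamma_add_INR by assumption; ring. }
  assert (EB : forall k, - RtoC 1 * v' k + psiB * v k = B k).
  { intro k; unfold B, psiB, v, v', hyp_term_deriv, hyp_term.
    rewrite !pochhammer_rising, !digamma_add_INR by assumption; ring. }
  assert (EV : forall k, v k = hyp2F1_coef b1 b2 c k).
  { intro k; unfold v, hyp_term, hyp2F1_coef.
    now rewrite !pochhammer_rising by assumption. }
  assert (gpv : poly_growth (fun k => psiB * v k))
    by (apply (poly_growth_mult (fun _ => psiB)); [apply poly_growth_const | exact gv]).
  assert (gA : poly_growth A).
  { apply (poly_growth_ext _ _ EA), poly_growth_plus; [|exact gu'].
    apply (poly_growth_mult (fun _ => psiA)); [apply poly_growth_const | exact gu]. }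
  assert (gB : poly_growth B).
  { apply (poly_growth_ext _ _ EB), poly_growth_plus; [|exact gpv].
    apply (poly_growth_mult (fun _ => - RtoC 1)); [apply poly_growth_const | exact gv']. }
  repeat split; try (apply ex_pseries_poly_growth; [|exact hz]; assumption).
  { apply ex_pseries_poly_growth; [now apply (poly_growth_ext _ _ EV) | exact hz]. }
  assert (gw := poly_growth_binom_term (b1 + b2 - c)).
  assert (W : Cpower (RtoC 1 - z) (c - b1 - b2) = CPSeries (binom_term (b1 + b2 - c)) z).
  { rewrite binomial_series by exact hz; f_equal; ring. }
  assert (WU : CPSeries (binom_term (b1 + b2 - c)) z * CPSeries u z = CPSeries v z).
  { rewrite <- CPSeries_conv by assumption.
    apply CPSeries_ext; intro k; now apply conv_hyp_term. }
  assert (WU' : CPSeries (binom_term (b1 + b2 - c)) z * CPSeries u' z = CPSeries v' z).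
  { rewrite <- CPSeries_conv by assumption.
    apply CPSeries_ext; intro k; now apply conv_hyp_term_deriv. }
  unfold hyp2F1.
  rewrite W, <- (CPSeries_ext _ _ z EA), <- (CPSeries_ext _ _ z EB), <- (CPSeries_ext _ _ z EV).
  (* The harmonic parts of the two series cancel by [WU']; by [WU] the rest is psiA + psiB times the
     series of [v]. *)
  rewrite !CPSeries_scal_plus, CPSeries_scal, Cmult_plus_distr_l, WU' by assumption.
  replace (CPSeries (binom_term (b1 + b2 - c)) z * (psiA * CPSeries u z))
    with (psiA * CPSeries v z) by (rewrite <- WU; ring).
  unfold psiA, psiB; ring.
Qed.
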